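(* Let $X,Y$ be Banach $D$-modules, $A$ a Banach $D$-algebra, and let $$M:X\times Y\to\mathcal{L}(D;X\to A),\qquad N:X\times Y\to\mathcal{L}(D;Y\to A)$$ be differentiable maps. The differential equation $$M(x,y)\circ dx+N(x,y)\circ dy=0$$ is integrable if and only if for all $(x,y)\in X\times Y$, all $dx,dx_1,dx_2\in X$ and all $dy,dy_1,dy_2\in Y$ $$\frac{\partial M(x,y)}{\partial x}\circ(dx_1,dx_2)=\frac{\partial M(x,y)}{\partial x}\circ(dx_2,dx_1),$$ $$\frac{\partial N(x,y)}{\partial y}\circ(dy_1,dy_2)=\frac{\partial N(x,y)}{\partial y}\circ(dy_2,dy_1),$$ $$\frac{\partial M(x,y)}{\partial y}\circ(dx,dy)=\frac{\partial N(x,y)}{\partial x}\circ(dy,dx).$$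
   Context: $D$ is a complete commutative (normed) ring of characteristic $0$; real scalars act on $D$-modules (derivatives are computed with real increments $t\to0$). $\mathcal{L}(D;X\to A)$ is the $D$-module of (continuous) $D$-linear maps. Derivatives are $D$-linear maps with $f(x+h)-f(x)=\frac{df(x)}{dx}\circ h+o(h)$; partial derivatives are derivatives in one variable with the other fixed. In $\frac{\partial M}{\partial x}\circ(h_1,h_2)$ (and similarly for the other partial derivatives of $M$ and $N$) the first argument $h_1$ is the argument of the linear map $M(x,y)$ and the second argument $h_2$ is the direction of differentiation: $\frac{\partial M(x,y)}{\partial x}\circ(h_1,h_2)=\frac{\partial}{\partial x}\bigl(M(x,y)\circ h_1\bigr)\circ h_2$. The equation $M\circ dx+N\circ dy=0$ is integrable (exact) if the differential form $M\circ dx+N\circ dy$ is integrable, i.e. there exists a differentiable map $u:X\times Y\to A$ with $\frac{\partial u(x,y)}{\partial x}=M(x,y)$ and $\frac{\partial u(x,y)}{\partial y}=N(x,y)$ for all $(x,y)$. *)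

(* Defs.v *)
From Stdlib Require Import Reals Lra Psatz ClassicalEpsilon FunctionalExtensionality
  ProofIrrelevance.
From Coquelicot Require Import Coquelicot.
Open Scope R_scope.

(* The norm of an [AbsRing] is submultiplicative; multiplicative norms are a
   special case. *)
Record CompleteNormedCommRing := {
  ring_abs :> AbsRing;
  ring_mult_comm : forall a b : ring_abs, mult a b = mult b a;
  ring_complete : forall F : (ring_abs -> Prop) -> Prop,
    ProperFilter F -> cauchy F -> exists l : ring_abs, filter_le F (locally l);
  (* [sum_n] adds n + 1 terms *)
  ring_char0 : forall n : nat, sum_n (fun _ : nat => one : ring_abs) n <> zero }.

(* A Banach D-module whose vectors can also be scaled by real numbers.  That the
   real action commutes with the action of D is not an axiom: x |-> d x is
   additive and bounded, hence R-linear. *)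
Record BanachModule (D : CompleteNormedCommRing) := {
  banach_car :> CompleteNormedModule D;
  rscal : R -> banach_car -> banach_car;
  rscal_assoc : forall (s t : R) (x : banach_car),
    rscal s (rscal t x) = rscal (s * t) x;
  rscal_one : forall x : banach_car, rscal 1 x = x;
  rscal_distr_l : forall (t : R) (x y : banach_car),
    rscal t (plus x y) = plus (rscal t x) (rscal t y);
  rscal_distr_r : forall (s t : R) (x : banach_car),
    rscal (s + t) x = plus (rscal s x) (rscal t x);
  norm_rscal : forall (t : R) (x : banach_car),
    norm (rscal t x) <= Rabs t * norm x }.

Arguments rscal {D b} _ _.
Arguments rscal_assoc {D b} _ _ _.
Arguments rscal_one {D b} _.
Arguments rscal_distr_l {D b} _ _ _.
Arguments rscal_distr_r {D b} _ _ _.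
Arguments norm_rscal {D b} _ _.

(* Neither associativity, nor commutativity, nor a unit is assumed. *)
Record BanachAlgebra (D : CompleteNormedCommRing) := {
  algebra_module :> BanachModule D;
  amult : algebra_module -> algebra_module -> algebra_module;
  amult_plus_l : forall a b c : algebra_module,
    amult (plus a b) c = plus (amult a c) (amult b c);
  amult_plus_r : forall a b c : algebra_module,
    amult a (plus b c) = plus (amult a b) (amult a c);
  amult_scal_l : forall (d : D) (a b : algebra_module),
    amult (scal d a) b = scal d (amult a b);
  amult_scal_r : forall (d : D) (a b : algebra_module),
    amult a (scal d b) = scal d (amult a b);
  norm_amult : forall a b : algebra_module, norm (amult a b) <= norm a * norm b }.

Section LinearMaps.

Context {D : CompleteNormedCommRing}.

(* [is_linear] demands boundedness; for modules on which the reals act this is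
   the same as continuity. *)
Record linmap (U V : NormedModule D) := Linmap {
  linmap_fun :> U -> V;
  linmap_linear : is_linear linmap_fun }.

Arguments Linmap {U V} _ _.
Arguments linmap_fun {U V} _ _.
Arguments linmap_linear {U V} _.

Context {U V : NormedModule D}.
Implicit Types f g h : linmap U V.

Lemma linmap_ext f g : (forall x, f x = g x) -> f = g.
Proof.
destruct f as [f Hf], g as [g Hg]; simpl; intros H.
assert (E : f = g) by (apply functional_extensionality; exact H).
subst g; f_equal; apply proof_irrelevance.
Qed.

Lemma is_linear_add (f g : U -> V) : is_linear f -> is_linear g ->
  is_linear (fun x => plus (f x) (g x)).
Proof.
intros Hf Hg.
apply (is_linear_comp (fun x => (f x, g x)) (fun p : V * V => plus (fst p) (snd p))).
- now apply is_linear_prod.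
- apply is_linear_plus.
Qed.

Lemma is_linear_neg (f : U -> V) : is_linear f -> is_linear (fun x => opp (f x)).
Proof. intros Hf; apply (is_linear_comp f opp); [easy | apply is_linear_opp]. Qed.

Lemma is_linear_mul (d : D) (f : U -> V) : is_linear f ->
  is_linear (fun x => scal d (f x)).
Proof.
intros Hf; apply (is_linear_comp f (scal d)); [easy |].
apply is_linear_scal_r, ring_mult_comm.
Qed.

Definition linmap_zero : linmap U V := Linmap (fun _ => zero) is_linear_zero.
Definition linmap_plus f g : linmap U V :=
  Linmap _ (is_linear_add f g (linmap_linear f) (linmap_linear g)).
Definition linmap_opp f : linmap U V :=
  Linmap _ (is_linear_neg f (linmap_linear f)).
Definition linmap_scal (d : D) f : linmap U V :=
  Linmap _ (is_linear_mul d f (linmap_linear f)).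

Definition linmap_AbelianMonoid_mixin : AbelianMonoid.mixin_of (linmap U V).
Proof.
apply (AbelianMonoid.Mixin _ linmap_plus linmap_zero);
  intros; apply linmap_ext; intros; simpl.
- apply plus_comm.
- apply plus_assoc.
- apply plus_zero_r.
Defined.

Canonical linmap_AbelianMonoid :=
  AbelianMonoid.Pack (linmap U V) linmap_AbelianMonoid_mixin (linmap U V).

Definition linmap_AbelianGroup_mixin : AbelianGroup.mixin_of linmap_AbelianMonoid.
Proof.
apply (AbelianGroup.Mixin _ linmap_opp).
intros f; apply linmap_ext; intros x; exact (plus_opp_r (f x)).
Defined.

Canonical linmap_AbelianGroup :=
  AbelianGroup.Pack (linmap U V) (AbelianGroup.Class _ _ linmap_AbelianGroup_mixin)
    (linmap U V).

Definition linmap_ModuleSpace_mixin : ModuleSpace.mixin_of D linmap_AbelianGroup.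
Proof.
apply (ModuleSpace.Mixin _ _ linmap_scal);
  intros; apply linmap_ext; intros; simpl.
- apply scal_assoc.
- apply (scal_one (V := V)).
- apply (scal_distr_l (V := V)).
- apply (scal_distr_r (V := V)).
Defined.

Canonical linmap_ModuleSpace :=
  ModuleSpace.Pack D (linmap U V) (ModuleSpace.Class _ _ _ linmap_ModuleSpace_mixin)
    (linmap U V).

(* The operator norm, sup of |f x| / |x|; at x = 0 the quotient is 0. *)
Definition opnorm f : R := real (Lub_Rbar (fun r => exists x, r = norm (f x) / norm x)).

Lemma opnorm_spec f :
  (forall x, norm (f x) <= opnorm f * norm x) /\ 0 <= opnorm f /\
  (forall C, 0 <= C -> (forall x, norm (f x) <= C * norm x) -> opnorm f <= C).
Proof.
assert (Q : forall C, 0 <= C -> (forall x, norm (f x) <= C * norm x) ->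
  forall x, norm (f x) / norm x <= C).
{ intros C HC H x.
  destruct (norm_ge_0 x) as [P | P].
  - apply Rle_div_l; [easy | apply H].
  - unfold Rdiv; rewrite <- P, Rinv_0; lra. }
unfold opnorm.
set (E := fun r => exists x, r = norm (f x) / norm x).
destruct (Lub_Rbar_correct E) as [Hub Hlub].
destruct (linear_norm _ (linmap_linear f)) as [C [HC HfC]].
assert (E0 : E 0).
{ exists zero; rewrite (linear_zero _ (linmap_linear f)), norm_zero; lra. }
assert (B : forall c, 0 <= c -> (forall x, norm (f x) <= c * norm x) ->
  Rbar_le (Lub_Rbar E) c).
{ intros c Hc H; apply Hlub; intros r [x ->]; simpl; now apply Q. }
generalize (B C (Rlt_le _ _ HC) HfC) (Hub 0 E0); intros H1 H2.
destruct (Lub_Rbar E) as [l | |]; simpl in *; try easy.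
split; [| split].
- intros x.
  destruct (norm_ge_0 x) as [P | P].
  + apply Rle_div_l; [easy |]. apply (Hub _ (ex_intro _ x eq_refl)).
  + generalize (HfC x); rewrite <- P; lra.
- easy.
- intros c Hc H; apply (B c Hc H).
Qed.

Lemma opnorm_bound f x : norm (f x) <= opnorm f * norm x.
Proof. apply opnorm_spec. Qed.

Lemma opnorm_ge_0 f : 0 <= opnorm f.
Proof. apply opnorm_spec. Qed.

Lemma opnorm_le f C : 0 <= C -> (forall x, norm (f x) <= C * norm x) -> opnorm f <= C.
Proof. apply opnorm_spec. Qed.

Lemma opnorm_triangle f g : opnorm (plus f g) <= opnorm f + opnorm g.
Proof.
apply opnorm_le.
- generalize (opnorm_ge_0 f) (opnorm_ge_0 g); lra.
- intros x; simpl; generalize (norm_triangle (f x) (g x)) (opnorm_bound f x) (opnorm_bound g x); lra.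
Qed.

Lemma opnorm_scal (d : D) f : opnorm (scal d f) <= abs d * opnorm f.
Proof.
assert (Hd : 0 <= abs d) by apply abs_ge_0.
apply opnorm_le.
- apply Rmult_le_pos; [easy | apply opnorm_ge_0].
- intros x; simpl.
  eapply Rle_trans; [apply (norm_scal (V := V)) |].
  rewrite Rmult_assoc; apply Rmult_le_compat_l; [easy | apply opnorm_bound].
Qed.

Lemma opnorm_eq_zero f : opnorm f = 0 -> f = zero.
Proof.
intros H; apply linmap_ext; intros x; simpl; apply norm_eq_zero.
generalize (opnorm_bound f x) (norm_ge_0 (f x)); rewrite H; lra.
Qed.

Lemma opnorm_opp f : opnorm (opp f) = opnorm f.
Proof.
assert (L : forall g, opnorm (opp g) <= opnorm g).
{ intros g; apply opnorm_le; [apply opnorm_ge_0 |].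
  intros x; simpl; rewrite norm_opp; apply opnorm_bound. }
apply Rle_antisym; [apply L |].
rewrite <- (opp_opp f) at 1; apply L.
Qed.

Definition linmap_UniformSpace_mixin : UniformSpace.mixin_of (linmap U V).
Proof.
apply (UniformSpace.Mixin _ linmap_zero (fun f eps g => opnorm (minus g f) < eps)).
- intros f eps; rewrite minus_eq_zero.
  apply Rle_lt_trans with 0; [| apply cond_pos].
  apply opnorm_le; [lra |].
  intros x; simpl; rewrite norm_zero; lra.
- intros f g eps H; rewrite <- opp_minus, opnorm_opp; exact H.
- intros f g h e1 e2 H1 H2.
  rewrite (minus_trans g).
  eapply Rle_lt_trans; [apply opnorm_triangle |]; lra.
Defined.

Canonical linmap_UniformSpace :=
  UniformSpace.Pack (linmap U V) linmap_UniformSpace_mixin (linmap U V).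

Canonical linmap_NormedModuleAux :=
  NormedModuleAux.Pack D (linmap U V)
    (NormedModuleAux.Class _ _ (ModuleSpace.class _ linmap_ModuleSpace)
      linmap_UniformSpace_mixin) (linmap U V).

Definition linmap_NormedModule_mixin : NormedModule.mixin_of D linmap_NormedModuleAux.
Proof.
apply (NormedModule.Mixin D linmap_NormedModuleAux opnorm 1).
- exact opnorm_triangle.
- exact opnorm_scal.
- easy.
- intros f g eps H; rewrite Rmult_1_l; exact H.
- exact opnorm_eq_zero.
Defined.

Canonical linmap_NormedModule :=
  NormedModule.Pack D (linmap U V)
    (NormedModule.Class _ _ _ linmap_NormedModule_mixin) (linmap U V).

End LinearMaps.

Arguments linmap {D} U V.
Arguments linmap_NormedModule {D} U V.
Arguments Linmap {D U V} _ _.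
Arguments linmap_fun {D U V} _ _.
Arguments linmap_linear {D U V} _.

Section Derivatives.

Context {D : CompleteNormedCommRing}.

Definition is_derivative {U V : NormedModule D} (f : U -> V) (x : U) (l : linmap U V) :=
  filterdiff f (locally x) l.

Definition differentiable {U V : NormedModule D} (f : U -> V) :=
  forall x, exists l, is_derivative f x l.

(* A total function: arbitrary where f is not differentiable. *)
Definition derivative {U V : NormedModule D} (f : U -> V) (x : U) : linmap U V :=
  epsilon (inhabits linmap_zero) (is_derivative f x).

Definition partial_x {X Y V : NormedModule D} (f : X * Y -> V) (p : X * Y) : linmap X V :=
  derivative (fun x => f (x, snd p)) (fst p).

Definition partial_y {X Y V : NormedModule D} (f : X * Y -> V) (p : X * Y) : linmap Y V :=
  derivative (fun y => f (fst p, y)) (snd p).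

(* The value B o (h1, h2) of the derivative B of an operator-valued map: h1 is the
   argument of the operator, h2 the direction of differentiation. *)
Definition app2 {U V W : NormedModule D} (B : linmap U (linmap_NormedModule V W)) (h1 : V) (h2 : U) : W :=
  B h2 h1.

Definition integrable {X Y V : NormedModule D}
    (M : X * Y -> linmap X V) (N : X * Y -> linmap Y V) :=
  exists u : X * Y -> V, differentiable u /\
    forall x y, partial_x u (x, y) = M (x, y) /\ partial_y u (x, y) = N (x, y).

Lemma derivative_correct {U V : NormedModule D} (f : U -> V) x :
  (exists l, is_derivative f x l) -> is_derivative f x (derivative f x).
Proof. apply epsilon_spec. Qed.

Lemma partial_x_correct {X Y V : NormedModule D} (f : X * Y -> V) x y :
  differentiable f -> is_derivative (fun x => f (x, y)) x (partial_x f (x, y)).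
Proof.
intros Hf; apply derivative_correct.
destruct (Hf (x, y)) as [l Hl].
assert (L : is_linear (fun h : X => (h, zero : Y))).
{ apply is_linear_prod; [apply is_linear_id | apply is_linear_zero]. }
exists (Linmap _ (is_linear_comp _ _ L (linmap_linear l))).
apply (filterdiff_comp' (fun x : X => (x, y)) f x (fun h => (h, zero)) l); [| exact Hl].
apply (filterdiff_ext_lin _ (fun h : X => (h, (fun _ => zero : Y) h))); [| easy].
apply (filterdiff_comp'_2 (fun x : X => x) (fun _ => y) (fun a b => (a, b)) x
  (fun h => h) (fun _ => zero) (fun a b => (a, b))).
- apply filterdiff_id.
- apply filterdiff_const.
- apply (filterdiff_ext_lin _ (fun p => p)); [| now intros []].
  apply (filterdiff_ext (fun p => p)); [now intros [] | apply filterdiff_id].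
Qed.

Lemma partial_y_correct {X Y V : NormedModule D} (f : X * Y -> V) x y :
  differentiable f -> is_derivative (fun y => f (x, y)) y (partial_y f (x, y)).
Proof.
intros Hf; apply derivative_correct.
destruct (Hf (x, y)) as [l Hl].
assert (L : is_linear (fun h : Y => (zero : X, h))).
{ apply is_linear_prod; [apply is_linear_zero | apply is_linear_id]. }
exists (Linmap _ (is_linear_comp _ _ L (linmap_linear l))).
apply (filterdiff_comp' (fun y : Y => (x, y)) f y (fun h => (zero, h)) l); [| exact Hl].
apply (filterdiff_comp'_2 (fun _ => x) (fun y : Y => y) (fun a b => (a, b)) y
  (fun _ => zero) (fun h => h) (fun a b => (a, b))).
- apply filterdiff_const.
- apply filterdiff_id.
- apply (filterdiff_ext_lin _ (fun p => p)); [| now intros []].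
  apply (filterdiff_ext (fun p => p)); [now intros [] | apply filterdiff_id].
Qed.

Lemma additive_nat (U : BanachModule D) (V : NormedModule D) (d : linmap U V) n (k : U) :
  norm (d (rscal (INR (S n)) k)) <= INR (S n) * norm (d k).
Proof.
induction n as [| n IH].
- simpl INR; rewrite rscal_one; lra.
- rewrite S_INR, rscal_distr_r, rscal_one, (linear_plus _ (linmap_linear d)).
  generalize (norm_triangle (d (rscal (INR (S n)) k)) (d k)); lra.
Qed.

Lemma plus_minus_l {G : AbelianGroup} (x k : G) : minus (plus x k) x = k.
Proof.
change (plus (plus x k) (opp x) = k).
now rewrite (plus_comm x k), <- plus_assoc, plus_opp_r, plus_zero_r.
Qed.

Lemma sub_minus_minus {G : AbelianGroup} (a p q : G) :
  plus p (opp q) = minus (minus a q) (minus a p).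
Proof.
change (plus p (opp q) = plus (plus a (opp q)) (opp (plus a (opp p)))).
rewrite opp_plus, opp_opp.
rewrite (plus_comm a (opp q)), <- plus_assoc, (plus_assoc a), plus_opp_r, plus_zero_l.
apply plus_comm.
Qed.

(* This is where the real scalars are needed. *)
Lemma is_derivative_unique {U : BanachModule D} {V : NormedModule D} (f : U -> V) x l :
  is_derivative f x l -> derivative f x = l.
Proof.
intros Hl.
assert (Hl' : is_derivative f x (derivative f x)).
{ apply derivative_correct; now exists l. }
revert Hl'; generalize (derivative f x); intros l' Hl'.
apply linmap_ext; intros h.
apply (plus_reg_r (opp (l h))); rewrite plus_opp_r.
pose (d := plus l' (opp l) : linmap U V).
change (d h = zero).
apply norm_eq_zero, Rle_antisym; [| apply norm_ge_0].
apply le_epsilon; intros eps Heps; rewrite Rplus_0_l.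
assert (Hn : 0 <= norm h) by apply norm_ge_0.
assert (He : 0 < eps / (2 * (norm h + 1))).
{ apply Rdiv_lt_0_compat; lra. }
destruct Hl as [_ Hl], Hl' as [_ Hl'].
specialize (Hl x (fun P H => H) (mkposreal _ He)).
specialize (Hl' x (fun P H => H) (mkposreal _ He)).
destruct (filter_and _ _ Hl Hl') as [r Hr]; simpl in Hr; clear Hl Hl'.
assert (Hr0 : 0 < r / (norm h + 1)).
{ apply Rdiv_lt_0_compat; [apply cond_pos | lra]. }
destruct (archimed_cor1 _ Hr0) as [n [Hnr Hn0]].
destruct n as [| n]; [inversion Hn0 |].
assert (P : 0 < INR (S n)) by (apply lt_0_INR; auto with arith).
set (k := rscal (/ INR (S n)) h : U).
assert (Eh : rscal (INR (S n)) k = h).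
{ unfold k; rewrite rscal_assoc, Rinv_r by lra; apply rscal_one. }
assert (Nk : norm k <= / INR (S n) * norm h).
{ unfold k; eapply Rle_trans; [apply norm_rscal |].
  rewrite Rabs_pos_eq; [lra |]. apply Rlt_le, Rinv_0_lt_compat, P. }
assert (Ek : minus (plus x k) x = k).
{ exact (plus_minus_l (G := U) x k). }
assert (Bk : ball x r (plus x k)).
{ apply (norm_compat1 (V := U)); rewrite Ek.
  eapply Rle_lt_trans; [apply Nk |].
  apply Rle_lt_trans with (/ INR (S n) * (norm h + 1)).
  - apply Rmult_le_compat_l; [apply Rlt_le, Rinv_0_lt_compat, P | lra].
  - apply Rlt_div_r in Hnr; lra. }
destruct (Hr _ Bk) as [R1 R2]; rewrite Ek in R1, R2.
set (a := minus (f (plus x k)) (f x)) in *.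
assert (Ed : d k = minus (minus a (l k)) (minus a (l' k))).
{ exact (sub_minus_minus (G := V) a (l' k) (l k)). }
assert (Nd : norm (d k) <= 2 * (eps / (2 * (norm h + 1)) * norm k)).
{ rewrite Ed; unfold minus at 1; eapply Rle_trans; [apply norm_triangle |].
  rewrite norm_opp; lra. }
rewrite <- Eh; eapply Rle_trans; [apply additive_nat |].
apply Rle_trans with (INR (S n) * (2 * (eps / (2 * (norm h + 1)) * (/ INR (S n) * norm h)))).
{ apply Rmult_le_compat_l; [lra |]. eapply Rle_trans; [exact Nd |].
  apply Rmult_le_compat_l; [lra |]. apply Rmult_le_compat_l; [lra | exact Nk]. }
replace (INR (S n) * (2 * (eps / (2 * (norm h + 1)) * (/ INR (S n) * norm h))))
  with (eps * norm h / (norm h + 1)) by (field; lra).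
apply Rle_div_l; [lra | nra].
Qed.

Lemma app2_derivative {U : BanachModule D} {V W : NormedModule D}
    (F : U -> linmap V W) x h1 h2 : (exists l, is_derivative F x l) ->
  app2 (derivative F x) h1 h2 = derivative (fun x' => F x' h1) x h2.
Proof.
intros HF; apply derivative_correct in HF; unfold app2.
assert (L : is_linear (fun g : linmap V W => g h1)).
{ split; [easy | easy |].
  exists (norm h1 + 1); split; [generalize (norm_ge_0 h1); lra |].
  intros g; generalize (opnorm_bound g h1) (opnorm_ge_0 g).
  change (norm g) with (opnorm g); lra. }
assert (H : is_derivative (fun x' => F x' h1) x
  (Linmap _ (is_linear_comp _ _ (linmap_linear (derivative F x)) L))).
{ apply (filterdiff_comp' F (fun g : linmap V W => g h1) x (derivative F x)
    (fun g => g h1)); [exact HF | now apply filterdiff_linear]. }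
now rewrite (is_derivative_unique _ _ _ H).
Qed.

End Derivatives.

(* Main.v *)
(* The pair (M, N) is a one-form w on Z = X x Y, and the three conditions say that the
   derivative of w at each point is a symmetric bilinear map.  Only real scalars matter:
   Z and A are real Banach spaces, and bounded D-linear maps are R-linear.  Let I(a, b)
   be the integral of w along the segment from a to b.  If w is differentiable at p with
   derivative B, then for a triangle a, b, c of diameter r within distance O(r) of p,
     I(a, b) + I(b, c) + I(c, a) = (B (b - a) (c - a) - B (c - a) (b - a)) / 2 + o(r^2).
   If w = du, the left side vanishes, and small triangles at p show that B is symmetric.
   Conversely, if every B is symmetric, Goursat's bisection argument (which needs no
   continuity of the derivative of w) makes the left side vanish for every triangle, so
   that u z = I(0, z) satisfies u z - u p = I(p, z) and hence du = w. *)

Require Import Defs.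
From Stdlib Require Import Reals Lra Lia List ClassicalEpsilon.
From Coquelicot Require Import Coquelicot.

(** * Linear combinations in a real module *)

Section LinearCombinations.

Context {V : ModuleSpace R_Ring}.

(** Syntax for proofs by reflection: a vector identity is reduced to equations between the real
    coefficients of finitely many atoms. *)
Inductive vexpr :=
  | VAtom (n : nat)
  | VZero
  | VPlus (e1 e2 : vexpr)
  | VOpp (e : vexpr)
  | VScal (r : R) (e : vexpr).

Fixpoint veval (env : list V) (e : vexpr) : V :=
  match e with
  | VAtom n => nth n env zero
  | VZero => zero
  | VPlus e1 e2 => plus (veval env e1) (veval env e2)
  | VOpp e => opp (veval env e)
  | VScal r e => scal r (veval env e)
  end.

Fixpoint vcoef (e : vexpr) (n : nat) : R :=
  match e with
  | VAtom m => if Nat.eqb m n then 1 else 0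
  | VZero => 0
  | VPlus e1 e2 => vcoef e1 n + vcoef e2 n
  | VOpp e => - vcoef e n
  | VScal r e => r * vcoef e n
  end.

Fixpoint lincomb (env : list V) (c : nat -> R) : V :=
  match env with
  | nil => zero
  | v :: env => plus (scal (c 0%nat) v) (lincomb env (fun n => c (S n)))
  end.

Lemma plus_swap (a b c d : V) : plus (plus a b) (plus c d) = plus (plus a c) (plus b d).
Proof.
rewrite <- !plus_assoc; f_equal; rewrite !plus_assoc; f_equal; apply plus_comm.
Qed.

Lemma lincomb_ext env c1 c2 : (forall n, c1 n = c2 n) -> lincomb env c1 = lincomb env c2.
Proof.
revert c1 c2; induction env as [| v env IH]; intros c1 c2 H; simpl; [easy |].
now rewrite H, (IH _ (fun n => c2 (S n))).
Qed.

Lemma lincomb_plus env c1 c2 :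
  lincomb env (fun n => c1 n + c2 n) = plus (lincomb env c1) (lincomb env c2).
Proof.
revert c1 c2; induction env as [| v env IH]; intros c1 c2; simpl.
- now rewrite plus_zero_l.
- rewrite (IH (fun n => c1 (S n)) (fun n => c2 (S n))), plus_swap; f_equal.
  apply (scal_distr_r (V := V)).
Qed.

Lemma lincomb_scal env r c : lincomb env (fun n => r * c n) = scal r (lincomb env c).
Proof.
revert c; induction env as [| v env IH]; intros c; simpl.
- now rewrite scal_zero_r.
- rewrite (IH (fun n => c (S n))), scal_distr_l; f_equal.
  symmetry; apply (scal_assoc (V := V)).
Qed.

Lemma lincomb_zero env : lincomb env (fun _ => 0) = zero.
Proof.
rewrite (lincomb_ext env _ (fun _ => 0 * 0)) by (intros; ring).
rewrite lincomb_scal; apply (scal_zero_l (V := V)).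
Qed.

Lemma lincomb_atom env m :
  lincomb env (fun n => if Nat.eqb m n then 1 else 0) = nth m env zero.
Proof.
revert m; induction env as [| v env IH]; intros [| m]; simpl; try easy.
- rewrite lincomb_zero, plus_zero_r; apply (scal_one (V := V)).
- rewrite IH; replace (scal 0 v) with (zero : V); [apply plus_zero_l |].
  symmetry; apply (scal_zero_l (V := V)).
Qed.

Lemma veval_lincomb env e : veval env e = lincomb env (vcoef e).
Proof.
induction e as [m | | e1 IH1 e2 IH2 | e IH | r e IH]; simpl.
- symmetry; apply lincomb_atom.
- symmetry; apply lincomb_zero.
- rewrite IH1, IH2; symmetry; apply lincomb_plus.
- rewrite IH, (lincomb_ext env (fun n => - vcoef e n) (fun n => (-1) * vcoef e n))
    by (intros; ring).
  rewrite lincomb_scal; symmetry; apply (scal_opp_one (V := V)).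
- rewrite IH; symmetry; apply lincomb_scal.
Qed.

(** A recursive conjunction instead of a bounded quantifier, so that [simpl] unfolds it into one
    real equation per atom. *)
Fixpoint same_coefs (n : nat) (c1 c2 : nat -> R) : Prop :=
  match n with
  | O => True
  | S n => c1 n = c2 n /\ same_coefs n c1 c2
  end.

Lemma lincomb_same_coefs env c1 c2 :
  same_coefs (length env) c1 c2 -> lincomb env c1 = lincomb env c2.
Proof.
intros H.
assert (E : forall n, (n < length env)%nat -> c1 n = c2 n).
{ revert H; induction (length env) as [| k IH]; intros H n Hn; [inversion Hn |].
  destruct H as [H0 H]; destruct (Nat.eq_dec n k) as [-> | Hk]; [exact H0 |].
  apply IH; [exact H |]; lia. }
clear H; revert c1 c2 E; induction env as [| v env IH]; intros c1 c2 E; simpl; [easy |].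
rewrite (E 0%nat) by (simpl; auto with arith).
rewrite (IH _ (fun n => c2 (S n))); [easy |].
intros n Hn; apply E; simpl; auto with arith.
Qed.

Lemma veval_eq env e1 e2 :
  same_coefs (length env) (vcoef e1) (vcoef e2) -> veval env e1 = veval env e2.
Proof. intros H; rewrite !veval_lincomb; now apply lincomb_same_coefs. Qed.

End LinearCombinations.

Ltac vec_index x env :=
  lazymatch env with
  | cons x _ => constr:(O)
  | cons _ ?env => let n := vec_index x env in constr:(S n)
  end.

Ltac vec_mem x env :=
  lazymatch env with
  | nil => constr:(false)
  | cons x _ => constr:(true)
  | cons _ ?env => vec_mem x env
  end.

Ltac vec_atoms V t env :=
  lazymatch t with
  | plus ?a ?b => let env := vec_atoms V a env in vec_atoms V b env
  | minus ?a ?b => let env := vec_atoms V a env in vec_atoms V b env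
  | opp ?a => vec_atoms V a env
  | scal _ ?a => vec_atoms V a env
  | zero => env
  | _ => lazymatch vec_mem t env with
         | true => env
         | false => constr:(cons (t : V) env)
         end
  end.

Ltac vec_reify t env :=
  lazymatch t with
  | plus ?a ?b => let a := vec_reify a env in let b := vec_reify b env in constr:(VPlus a b)
  | minus ?a ?b => let a := vec_reify a env in let b := vec_reify b env in
      constr:(VPlus a (VOpp b))
  | opp ?a => let a := vec_reify a env in constr:(VOpp a)
  | scal ?r ?a => let a := vec_reify a env in constr:(VScal r a)
  | zero => constr:(VZero)
  | _ => let n := vec_index t env in constr:(VAtom n)
  end.

(* Decides equations between linear combinations of vectors of a real module by
   comparing the coefficients of each atom; side conditions of [field] are left open. *)
Ltac vec V :=
  lazymatch goal with
  | |- @eq _ ?a ?b =>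
      let env := vec_atoms V a (@nil V) in
      let env := vec_atoms V b env in
      let ea := vec_reify a env in
      let eb := vec_reify b env in
      change (@veval V env ea = @veval V env eb);
      apply veval_eq; simpl; repeat split; first [ring | field | lra]
  end.

(** * One-forms and their integrals along segments *)

Section OneForms.

Context {E : NormedModule R_AbsRing} {F : CompleteNormedModule R_AbsRing}.

Record bounded_bilinear (B : E -> E -> F) : Prop := {
  bilinear_l : forall h : E, is_linear (fun k => B k h);
  bilinear_r : forall k : E, is_linear (B k);
  bilinear_norm : exists C, 0 <= C /\ forall k h : E, norm (B k h) <= C * norm k * norm h }.

(** Differentiability in operator norm, spelled out on vectors: [delta] is uniform in h. In [B k h]
    the direction of differentiation is k, and h is the argument of the form. *)
Definition form_derivative (w : E -> E -> F) (p : E) (B : E -> E -> F) :=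
  forall eps, 0 < eps -> exists delta, 0 < delta /\
  forall z h : E, norm (minus z p) < delta ->
    norm (minus (minus (w z h) (w p h)) (B (minus z p) h)) <= eps * norm (minus z p) * norm h.

Record differentiable_form (w : E -> E -> F) : Prop := {
  form_linear : forall z, is_linear (w z);
  form_diff : forall p, exists B, bounded_bilinear B /\ form_derivative w p B }.

Definition segment (a b : E) (t : R) : E := plus a (scal t (minus b a)).

Definition midpoint (a b : E) : E := scal (1 / 2) (plus a b).

Definition path_integral (w : E -> E -> F) (a b : E) : F :=
  RInt (fun t => w (segment a b t) (minus b a)) 0 1.

Definition circulation (w : E -> E -> F) (a b c : E) : F :=
  plus (plus (path_integral w a b) (path_integral w b c)) (path_integral w c a).

Lemma norm_scal_le {V : NormedModule R_AbsRing} (t : R) (v : V) :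
  norm (scal t v) <= Rabs t * norm v.
Proof. exact (norm_scal (V := V) t v). Qed.

Lemma norm_le_eq {V : NormedModule R_AbsRing} (x y : V) (r : R) :
  x = y -> norm y <= r -> norm x <= r.
Proof. now intros ->. Qed.

Lemma norm_minus_self {V : NormedModule R_AbsRing} (x : V) : norm (minus x x) = 0.
Proof. rewrite minus_eq_zero; apply (norm_zero (V := V)). Qed.

Lemma norm_minus_sym {V : NormedModule R_AbsRing} (x y : V) :
  norm (minus x y) = norm (minus y x).
Proof. rewrite <- norm_opp; f_equal; vec V. Qed.

Lemma norm_minus_trans {V : NormedModule R_AbsRing} (x y z : V) :
  norm (minus x z) <= norm (minus x y) + norm (minus y z).
Proof.
replace (minus x z) with (plus (minus x y) (minus y z)) by vec V.
apply norm_triangle.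
Qed.

Lemma segment_dist (a b p : E) (r t : R) : 0 <= t <= 1 ->
  norm (minus a p) <= r -> norm (minus b p) <= r -> norm (minus (segment a b t) p) <= r.
Proof.
intros Ht Ha Hb.
replace (minus (segment a b t) p) with (plus (scal (1 - t) (minus a p)) (scal t (minus b p)))
  by (unfold segment; vec E).
eapply Rle_trans; [apply (norm_triangle (V := E)) |].
generalize (norm_scal_le (1 - t) (minus a p)) (norm_scal_le t (minus b p)).
rewrite !Rabs_pos_eq by lra.
nra.
Qed.

(** The derivative estimate with error 1 gives the local Lipschitz constant [1 + C], where C bounds
    B. *)
Lemma form_continuous w (p : E) : differentiable_form w ->
  exists C delta, 0 <= C /\ 0 < delta /\ forall z h : E, norm (minus z p) < delta ->
    norm (minus (w z h) (w p h)) <= C * norm (minus z p) * norm h.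
Proof.
intros [_ Hw].
destruct (Hw p) as [B [[_ _ [C [HC HB]]] HD]].
destruct (HD 1 Rlt_0_1) as [delta [Hdelta H]].
exists (1 + C), delta; split; [lra | split; [easy |]].
intros z h Hz.
replace (minus (w z h) (w p h))
  with (plus (minus (minus (w z h) (w p h)) (B (minus z p) h)) (B (minus z p) h)) by vec F.
eapply Rle_trans; [apply (norm_triangle (V := F)) |].
generalize (H z h Hz) (HB (minus z p) h); lra.
Qed.

Lemma form_segment_continuous w a b h t : differentiable_form w ->
  continuous (fun t => w (segment a b t) h) t.
Proof.
intros Hw; apply filterlim_locally; intros eps.
destruct (form_continuous w (segment a b t) Hw) as [C [delta [HC [Hdelta H]]]].
set (m := norm (minus b a)); assert (Hm : 0 <= m) by apply norm_ge_0.
assert (Hh : 0 <= norm h) by apply norm_ge_0.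
assert (Heps := cond_pos eps).
assert (P1 : 0 < delta / (m + 1)) by (apply Rdiv_lt_0_compat; lra).
assert (Q : 0 < C * (m + 1) * (norm h + 1) + 1).
{ assert (0 <= C * (m + 1) * (norm h + 1)); [| lra].
  apply Rmult_le_pos; [apply Rmult_le_pos |]; lra. }
assert (P2 : 0 < eps / (C * (m + 1) * (norm h + 1) + 1)).
{ apply Rdiv_lt_0_compat; lra. }
(* The first bound keeps the moving point within [delta], the second makes the Lipschitz estimate
   smaller than [eps]; the added ones keep the denominators positive. *)
exists (mkposreal _ (Rmin_pos _ _ P1 P2)); intros s Hs.
change (Rabs (s + - t) < Rmin (delta / (m + 1)) (eps / (C * (m + 1) * (norm h + 1) + 1))) in Hs.
assert (Hs1 := Rlt_le_trans _ _ _ Hs (Rmin_l _ _)).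
assert (Hs2 := Rlt_le_trans _ _ _ Hs (Rmin_r _ _)).
apply Rlt_div_r in Hs1; [| lra]; apply Rlt_div_r in Hs2; [| lra].
apply (norm_compat1 (V := F)).
assert (Hd : norm (minus (segment a b s) (segment a b t)) <= Rabs (s + - t) * m).
{ replace (minus (segment a b s) (segment a b t)) with (scal (s + - t) (minus b a))
    by (unfold segment; vec E).
  apply norm_scal_le. }
assert (Ha := Rabs_pos (s + - t)).
eapply Rle_lt_trans; [apply H; nra |].
eapply Rle_lt_trans; [| exact Hs2].
apply Rle_trans with (C * (Rabs (s + - t) * m) * norm h).
- apply Rmult_le_compat_r; [easy |]; apply Rmult_le_compat_l; easy.
- replace (C * (Rabs (s + - t) * m) * norm h) with (Rabs (s + - t) * (C * m * norm h)) by ring.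
  apply Rmult_le_compat_l; [easy |].
  assert (0 <= C * m) by now apply Rmult_le_pos.
  nra.
Qed.

Lemma path_integral_correct w a b : differentiable_form w ->
  is_RInt (fun t => w (segment a b t) (minus b a)) 0 1 (path_integral w a b).
Proof.
intros Hw; apply RInt_correct, ex_RInt_continuous; intros t _.
now apply form_segment_continuous.
Qed.

(** Affine substitution with the endpoints as variables, so that they are matched by [ring] and not
    by unification. *)
Lemma is_RInt_affine (f : R -> F) u v c d l : u * 0 + v = c -> u * 1 + v = d ->
  is_RInt f c d l -> is_RInt (fun t => scal u (f (u * t + v))) 0 1 l.
Proof. intros <- <-; exact (is_RInt_comp_lin f u v 0 1 l). Qed.

Lemma path_integral_swap w (a b : E) : differentiable_form w ->
  path_integral w b a = opp (path_integral w a b).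
Proof.
intros Hw; apply is_RInt_unique.
assert (H := is_RInt_swap _ _ _ _ (path_integral_correct w a b Hw)).
(* Substitution of 1 - t for t; the factor -1 moves into the form by linearity and reverses the
   increment. *)
apply (is_RInt_affine _ (-1) 1) in H; [| ring | ring].
revert H; apply is_RInt_ext; intros t _.
rewrite <- (linear_scal _ (form_linear _ Hw _)); f_equal; unfold segment; vec E.
Qed.

(** The integral is cut at t = 1/2 and each half is rescaled to [0, 1]; the factor 1/2 of the
    substitution turns [minus b a] into the increment of the half segment. *)
Lemma path_integral_midpoint w a b : differentiable_form w ->
  path_integral w a b =
  plus (path_integral w a (midpoint a b)) (path_integral w (midpoint a b) b).
Proof.
intros Hw; apply is_RInt_unique.
assert (Hex : forall s t, ex_RInt (fun t => w (segment a b t) (minus b a)) s t).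
{ intros s t; apply ex_RInt_continuous; intros; now apply form_segment_continuous. }
assert (H1 := RInt_correct _ _ _ (Hex 0 (1 / 2))).
assert (H2 := RInt_correct _ _ _ (Hex (1 / 2) 1)).
replace (path_integral w a (midpoint a b))
  with (RInt (fun t => w (segment a b t) (minus b a)) 0 (1 / 2)).
replace (path_integral w (midpoint a b) b)
  with (RInt (fun t => w (segment a b t) (minus b a)) (1 / 2) 1).
{ apply (is_RInt_Chasles _ _ _ _ _ _ H1 H2). }
- symmetry; apply is_RInt_unique.
  apply (is_RInt_affine _ (1 / 2) (1 / 2)) in H2; [| ring | field].
  revert H2; apply is_RInt_ext; intros t _.
  rewrite <- (linear_scal _ (form_linear _ Hw _)); f_equal; unfold segment, midpoint; vec E.
- symmetry; apply is_RInt_unique.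
  apply (is_RInt_affine _ (1 / 2) 0) in H1; [| ring | field].
  revert H1; apply is_RInt_ext; intros t _.
  rewrite <- (linear_scal _ (form_linear _ Hw _)); f_equal; unfold segment, midpoint; vec E.
Qed.

Lemma is_RInt_linear_function (d : F) : is_RInt (fun t => scal t d) 0 1 (scal (1 / 2) d).
Proof.
replace (scal (1 / 2) d) with (minus (scal (1 ^ 2 / 2) d) (scal (0 ^ 2 / 2) d)) by vec F.
apply (is_RInt_derive (fun t => scal (t ^ 2 / 2) d)).
- intros t _; apply (is_derive_scal_l (fun t => t ^ 2 / 2) t t d).
  auto_derive; [easy | field].
- intros t _; apply (continuous_scal_l (V := F) (fun t : R => t) d), continuous_id.
Qed.

(** On the segment z = a + t h, the first-order model w(p) h + B (z - p) h is affine in t, so its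
    integral is its value at the midpoint. Balls are convex, hence the remainder is at most
    [eps * r * norm h] for every t. *)
Lemma path_integral_approx w (p : E) B eps r (a b : E) :
  differentiable_form w -> bounded_bilinear B -> 0 <= eps ->
  (forall z h : E, norm (minus z p) <= r ->
    norm (minus (minus (w z h) (w p h)) (B (minus z p) h)) <= eps * norm (minus z p) * norm h) ->
  norm (minus a p) <= r -> norm (minus b p) <= r ->
  norm (minus (path_integral w a b)
    (plus (w p (minus b a)) (B (minus (midpoint a b) p) (minus b a))))
  <= eps * r * norm (minus b a).
Proof.
intros Hw HB Heps H Ha Hb.
set (h := minus b a).
assert (HI := is_RInt_minus _ _ _ _ _ _ (path_integral_correct w a b Hw)
  (is_RInt_plus _ _ _ _ _ _ (is_RInt_const 0 1 (plus (w p h) (B (minus a p) h)))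
    (is_RInt_linear_function (B h h)))).
replace (plus (w p h) (B (minus (midpoint a b) p) h))
  with (plus (scal (1 - 0) (plus (w p h) (B (minus a p) h))) (scal (1 / 2) (B h h))).
- replace (eps * r * norm h) with ((1 - 0) * (eps * r * norm h)) by ring.
  refine (norm_RInt_le_const _ _ _ _ _ Rle_0_1 _ HI).
  intros t Ht; simpl; fold h.
  assert (Hz := segment_dist a b p r t Ht Ha Hb).
  apply (norm_le_eq (V := F) _
    (minus (minus (w (segment a b t) h) (w p h)) (B (minus (segment a b t) p) h))).
  2: { eapply Rle_trans; [apply (H _ h Hz) |].
    apply Rmult_le_compat_r; [apply norm_ge_0 |].
    now apply Rmult_le_compat_l. }
  replace (minus (segment a b t) p) with (plus (minus a p) (scal t h))
    by (unfold segment, h; vec E).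
  rewrite (linear_plus _ (bilinear_l _ HB h)), (linear_scal _ (bilinear_l _ HB h)).
  vec F.
- replace (minus (midpoint a b) p) with (plus (minus a p) (scal (1 / 2) h))
    by (unfold midpoint, h; vec E).
  rewrite (linear_plus _ (bilinear_l _ HB h)), (linear_scal _ (bilinear_l _ HB h)).
  vec F.
Qed.

(** In the sum of the three edge estimates the terms in [w p] cancel, because the increments add up
    to zero; the terms in B leave half of its antisymmetric part on the two edges at a. *)
Lemma circulation_approx w (p : E) B eps r (a b c : E) :
  differentiable_form w -> bounded_bilinear B -> 0 <= eps ->
  (forall z h : E, norm (minus z p) <= r ->
    norm (minus (minus (w z h) (w p h)) (B (minus z p) h)) <= eps * norm (minus z p) * norm h) ->
  norm (minus a p) <= r -> norm (minus b p) <= r -> norm (minus c p) <= r ->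
  norm (minus (circulation w a b c)
    (scal (1 / 2) (minus (B (minus b a) (minus c a)) (B (minus c a) (minus b a)))))
  <= eps * r * (norm (minus b a) + norm (minus c b) + norm (minus a c)).
Proof.
intros Hw HB Heps H Ha Hb Hc.
assert (H1 := path_integral_approx w p B eps r a b Hw HB Heps H Ha Hb).
assert (H2 := path_integral_approx w p B eps r b c Hw HB Heps H Hb Hc).
assert (H3 := path_integral_approx w p B eps r c a Hw HB Heps H Hc Ha).
unfold circulation.
set (i1 := path_integral w a b) in *.
set (i2 := path_integral w b c) in *.
set (i3 := path_integral w c a) in *.
match goal with |- norm ?x <= _ =>
  match type of H1 with norm ?x1 <= _ =>
  match type of H2 with norm ?x2 <= _ =>
  match type of H3 with norm ?x3 <= _ =>
    replace x with (plus (plus x1 x2) x3)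
  end end end
end.
- rewrite !Rmult_plus_distr_l.
  eapply Rle_trans; [apply (norm_triangle (V := F)) |].
  apply Rplus_le_compat; [| exact H3].
  eapply Rle_trans; [apply (norm_triangle (V := F)) |].
  now apply Rplus_le_compat.
- clear H1 H2 H3.
  (* All vectors are written in terms of x, y and z, so that expansion by bilinearity leaves only
     atoms of the form [w p _] and [B _ _] on these three. *)
  set (x := minus a p); set (y := minus b a); set (z := minus c a).
  replace (minus c b) with (minus z y) by (unfold x, y, z; vec E).
  replace (minus a c) with (opp z) by (unfold x, y, z; vec E).
  replace (minus (midpoint a b) p) with (plus x (scal (1 / 2) y))
    by (unfold midpoint, x, y, z; vec E).
  replace (minus (midpoint b c) p) with (plus x (scal (1 / 2) (plus y z)))
    by (unfold midpoint, x, y, z; vec E).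
  replace (minus (midpoint c a) p) with (plus x (scal (1 / 2) z))
    by (unfold midpoint, x, y, z; vec E).
  assert (L := form_linear _ Hw p).
  assert (L1 := bilinear_l _ HB); assert (L2 := bilinear_r _ HB).
  unfold minus.
  repeat first [rewrite (linear_plus _ L) | rewrite (linear_opp _ _ L)
    | rewrite (linear_plus _ (L1 _)) | rewrite (linear_opp _ _ (L1 _))
    | rewrite (linear_scal _ (L1 _))
    | rewrite (linear_plus _ (L2 _)) | rewrite (linear_opp _ _ (L2 _))].
  vec F.
Qed.

(** * Goursat's lemma for triangles *)

Definition small_triangle (d : R) (a b c : E) : Prop :=
  norm (minus b a) <= d /\ norm (minus c b) <= d /\ norm (minus a c) <= d.

Lemma norm_half_le (x y : E) d : x = scal (1 / 2) y -> norm y <= d -> norm x <= d / 2.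
Proof.
intros -> Hy; generalize (norm_scal_le (1 / 2) y); rewrite Rabs_pos_eq by lra; lra.
Qed.

(** The edges of the middle triangle [m n l] are each traversed twice, in opposite directions, and
    cancel; the outer edges recombine at their midpoints. *)
Lemma circulation_split w (a b c : E) : differentiable_form w ->
  let m := midpoint a b in let n := midpoint b c in let l := midpoint c a in
  circulation w a b c =
  plus (plus (circulation w a m l) (circulation w m b n))
    (plus (circulation w l n c) (circulation w m n l)).
Proof.
intros Hw m n l; unfold circulation.
rewrite (path_integral_midpoint w a b Hw), (path_integral_midpoint w b c Hw),
  (path_integral_midpoint w c a Hw); fold m n l.
rewrite (path_integral_swap w m l Hw), (path_integral_swap w m n Hw),
  (path_integral_swap w n l Hw).
vec F.
Qed.

(** Some quarter carries at least a fourth of the circulation. The size bound is quantified over d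
    inside, so that the chosen quarter does not depend on d and the step can be iterated; the bound
    on [minus a' a] makes the first vertices a Cauchy sequence. *)
Lemma circulation_bisect w (a b c : E) : differentiable_form w ->
  exists a' b' c' : E,
    (forall d, small_triangle d a b c ->
      small_triangle (d / 2) a' b' c' /\ norm (minus a' a) <= d / 2) /\
    norm (circulation w a b c) <= 4 * norm (circulation w a' b' c').
Proof.
intros Hw.
pose (m := midpoint a b); pose (n := midpoint b c); pose (l := midpoint c a).
assert (HT : norm (circulation w a b c) <=
  norm (circulation w a m l) + norm (circulation w m b n) +
  (norm (circulation w l n c) + norm (circulation w m n l))).
{ rewrite (circulation_split w a b c Hw).
  eapply Rle_trans; [apply (norm_triangle (V := F)) |].
  apply Rplus_le_compat; apply (norm_triangle (V := F)). }
assert (S1 : forall d, small_triangle d a b c ->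
  small_triangle (d / 2) a m l /\ norm (minus a a) <= d / 2).
{ intros d [H1 [H2 H3]]; split; [split; [| split] |].
  - apply (norm_half_le _ (minus b a)); [unfold m, midpoint; vec E | easy].
  - apply (norm_half_le _ (minus c b)); [unfold m, l, midpoint; vec E | easy].
  - apply (norm_half_le _ (minus a c)); [unfold l, midpoint; vec E | easy].
  - rewrite norm_minus_self; generalize (norm_ge_0 (minus b a)); lra. }
assert (S2 : forall d, small_triangle d a b c ->
  small_triangle (d / 2) m b n /\ norm (minus m a) <= d / 2).
{ intros d [H1 [H2 H3]]; split; [split; [| split] |].
  - apply (norm_half_le _ (minus b a)); [unfold m, midpoint; vec E | easy].
  - apply (norm_half_le _ (minus c b)); [unfold n, midpoint; vec E | easy].
  - apply (norm_half_le _ (minus a c)); [unfold m, n, midpoint; vec E | easy].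
  - apply (norm_half_le _ (minus b a)); [unfold m, midpoint; vec E | easy]. }
assert (S3 : forall d, small_triangle d a b c ->
  small_triangle (d / 2) l n c /\ norm (minus l a) <= d / 2).
{ intros d [H1 [H2 H3]]; split; [split; [| split] |].
  - apply (norm_half_le _ (minus b a)); [unfold l, n, midpoint; vec E | easy].
  - apply (norm_half_le _ (minus c b)); [unfold n, midpoint; vec E | easy].
  - apply (norm_half_le _ (minus a c)); [unfold l, midpoint; vec E | easy].
  - apply (norm_half_le _ (minus c a)); [unfold l, midpoint; vec E |].
    now rewrite norm_minus_sym. }
assert (S4 : forall d, small_triangle d a b c ->
  small_triangle (d / 2) m n l /\ norm (minus m a) <= d / 2).
{ intros d [H1 [H2 H3]]; split; [split; [| split] |].
  - apply (norm_half_le _ (minus c a)); [unfold m, n, midpoint; vec E |].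
    now rewrite norm_minus_sym.
  - apply (norm_half_le _ (minus a b)); [unfold l, n, midpoint; vec E |].
    now rewrite norm_minus_sym.
  - apply (norm_half_le _ (minus b c)); [unfold l, m, midpoint; vec E |].
    now rewrite norm_minus_sym.
  - apply (norm_half_le _ (minus b a)); [unfold m, midpoint; vec E | easy]. }
set (t := norm (circulation w a b c)) in *.
destruct (Rle_dec t (4 * norm (circulation w a m l))) as [H1 | H1].
{ now exists a, m, l. }
destruct (Rle_dec t (4 * norm (circulation w m b n))) as [H2 | H2].
{ now exists m, b, n. }
destruct (Rle_dec t (4 * norm (circulation w l n c))) as [H3 | H3].
{ now exists l, n, c. }
(* The other three circulations are each below [t / 4], so [HT] forces at least [t / 4] on the
   middle triangle. *)
exists m, n, l; split; [exact S4 | lra].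
Qed.

(** Sequential completeness in terms of the norm, a form that passes to products factor by
    factor. *)
Definition norm_complete (V : NormedModule R_AbsRing) : Prop :=
  forall u : nat -> V,
  (forall eps, 0 < eps -> exists N, forall n, (N <= n)%nat -> norm (minus (u n) (u N)) <= eps) ->
  exists p : V, forall eps, 0 < eps ->
    exists N, forall n, (N <= n)%nat -> norm (minus (u n) p) <= eps.

Lemma geometric_limit (V : NormedModule R_AbsRing) (u : nat -> V) (d : R) :
  norm_complete V -> 0 <= d ->
  (forall n, norm (minus (u (S n)) (u n)) <= d / 2 ^ S n) ->
  exists p : V, forall n, norm (minus (u n) p) <= d / 2 ^ n.
Proof.
intros Hc Hd Hu.
assert (P : forall n, 0 < 2 ^ n) by (intros; apply pow_lt; lra).
(* The right side is the exact geometric sum of the steps; keeping the subtracted term lets the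
   induction on k close. *)
assert (T : forall k n, norm (minus (u (k + n)%nat) (u n)) <= d / 2 ^ n - d / 2 ^ (k + n)).
{ induction k as [| k IH]; intros n; simpl.
  - rewrite norm_minus_self; lra.
  - eapply Rle_trans; [apply (norm_minus_trans _ (u (k + n)%nat)) |].
    generalize (IH n) (Hu (k + n)%nat); simpl.
    replace (d / 2 ^ (k + n)) with (2 * (d / (2 * 2 ^ (k + n)))); [lra |].
    field; apply Rgt_not_eq, P. }
assert (T' : forall n m, (n <= m)%nat -> norm (minus (u m) (u n)) <= d / 2 ^ n).
{ intros n m H; replace m with (m - n + n)%nat by lia.
  eapply Rle_trans; [apply T |].
  assert (0 <= d / 2 ^ (m - n + n)); [| lra].
  apply Rmult_le_pos; [easy | apply Rlt_le, Rinv_0_lt_compat, P]. }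
destruct (Hc u) as [p Hp].
- intros eps Heps.
  destruct (pow_lt_1_zero (1 / 2)) with (y := eps / (d + 1)) as [N HN].
  { rewrite Rabs_pos_eq; lra. }
  { apply Rdiv_lt_0_compat; lra. }
  exists N; intros n Hn; eapply Rle_trans; [apply T', Hn |].
  specialize (HN N (le_n N)); rewrite Rabs_pos_eq in HN by (apply pow_le; lra).
  apply Rlt_div_r in HN; [| lra].
  replace (1 / 2) with (/ 2) in HN by lra; rewrite pow_inv in HN.
  assert (0 < / 2 ^ N) by apply Rinv_0_lt_compat, P.
  unfold Rdiv; nra.
- exists p; intros n; apply le_epsilon; intros eps Heps.
  destruct (Hp eps Heps) as [N HN].
  eapply Rle_trans; [apply (norm_minus_trans _ (u (n + N)%nat)) |].
  apply Rplus_le_compat; [| apply HN; lia].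
  rewrite norm_minus_sym; apply T'; lia.
Qed.

(** Symmetry of the derivative says that the exterior derivative of w vanishes. *)
Definition closed_form (w : E -> E -> F) : Prop :=
  forall p, exists B, bounded_bilinear B /\ form_derivative w p B /\
    forall h k, B h k = B k h.

(** Repeated bisection gives triangles of size [d / 2 ^ n] shrinking to a point p and keeping at
    least 1/4^n of the circulation. At p the symmetric B drops out of [circulation_approx], which
    leaves a bound o(1/4^n). *)
Lemma circulation_zero w (a b c : E) : norm_complete E ->
  differentiable_form w -> closed_form w -> circulation w a b c = zero.
Proof.
intros HE Hw Hcl.
assert (Hstep : forall t : E * E * E, exists t' : E * E * E,
  (forall d, small_triangle d (fst (fst t)) (snd (fst t)) (snd t) ->
    small_triangle (d / 2) (fst (fst t')) (snd (fst t')) (snd t') /\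
    norm (minus (fst (fst t')) (fst (fst t))) <= d / 2) /\
  norm (circulation w (fst (fst t)) (snd (fst t)) (snd t)) <=
    4 * norm (circulation w (fst (fst t')) (snd (fst t')) (snd t'))).
{ intros [[x y] z]; destruct (circulation_bisect w x y z Hw) as [x' [y' [z' H]]].
  now exists (x', y', z'). }
(* Choice turns bisection into a function on triangles, which is iterated from [(a, b, c)]. *)
destruct (ClassicalEpsilon.choice _ Hstep) as [f Hf]; clear Hstep.
pose (T n := Nat.iter n f (a, b, c)).
pose (u n := fst (fst (T n))); pose (v n := snd (fst (T n))); pose (z n := snd (T n)).
pose (d := norm (minus b a) + norm (minus c b) + norm (minus a c)).
assert (Hd : 0 <= d).
{ generalize (norm_ge_0 (minus b a)) (norm_ge_0 (minus c b)) (norm_ge_0 (minus a c)).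
  unfold d; lra. }
assert (P : forall n, 0 < 2 ^ n) by (intros; apply pow_lt; lra).
assert (Hh : forall n, d / 2 ^ S n = d / 2 ^ n / 2).
{ intros n; simpl; field; apply Rgt_not_eq, P. }
assert (Hsmall : forall n, small_triangle (d / 2 ^ n) (u n) (v n) (z n)).
{ induction n as [| n IH].
  - unfold u, v, z, small_triangle; simpl; unfold d, Rdiv; rewrite Rinv_1.
    generalize (norm_ge_0 (minus b a)) (norm_ge_0 (minus c b)) (norm_ge_0 (minus a c)).
    repeat split; lra.
  - rewrite Hh; now apply (Hf (T n)). }
assert (Hcirc : forall n, norm (circulation w a b c) <=
  4 ^ n * norm (circulation w (u n) (v n) (z n))).
{ induction n as [| n IH].
  - unfold u, v, z; simpl; lra.
  - eapply Rle_trans; [exact IH |]; simpl pow.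
    rewrite (Rmult_comm 4), Rmult_assoc; apply Rmult_le_compat_l; [apply pow_le; lra |].
    apply (Hf (T n)). }
destruct (geometric_limit E u d HE Hd) as [p Hp].
{ intros n; rewrite Hh; apply (Hf (T n)), Hsmall. }
destruct (Hcl p) as [B [HB [HD Hsym]]].
apply (norm_eq_zero (V := F)), Rle_antisym; [| apply norm_ge_0].
apply le_epsilon; intros eps Heps; rewrite Rplus_0_l.
(* With q = 1/2^n, the radius [2 * (d * q)] times the perimeter bound [3 * (d * q)] is 6 d^2 q^2;
   the added 1 covers d = 0. *)
assert (He : 0 < eps / (6 * d * d + 1)) by (apply Rdiv_lt_0_compat; nra).
destruct (HD _ He) as [delta [Hdelta HDd]].
destruct (pow_lt_1_zero (1 / 2)) with (y := delta / (2 * d + 1)) as [n Hn].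
{ rewrite Rabs_pos_eq; lra. }
{ apply Rdiv_lt_0_compat; lra. }
specialize (Hn n (le_n n)); rewrite Rabs_pos_eq in Hn by (apply pow_le; lra).
apply Rlt_div_r in Hn; [| lra].
replace (1 / 2) with (/ 2) in Hn by lra; rewrite pow_inv in Hn.
set (q := / 2 ^ n) in *; assert (Hq : 0 < q) by apply Rinv_0_lt_compat, P.
destruct (Hsmall n) as [S1 [S2 S3]].
assert (Hu := Hp n).
change (d / 2 ^ n) with (d * q) in *.
(* [u n] is within d q of p, and the other vertices are one edge away from it. *)
assert (Hv : norm (minus (v n) p) <= 2 * (d * q)).
{ generalize (norm_minus_trans (v n) (u n) p); lra. }
assert (Hz : norm (minus (z n) p) <= 2 * (d * q)).
{ generalize (norm_minus_trans (z n) (u n) p); rewrite (norm_minus_sym (z n) (u n)); lra. }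
assert (H := circulation_approx w p B _ (2 * (d * q)) (u n) (v n) (z n) Hw HB (Rlt_le _ _ He)).
eapply Rle_trans; [apply (Hcirc n) |].
assert (HC : norm (circulation w (u n) (v n) (z n)) <=
  eps / (6 * d * d + 1) * (2 * (d * q)) * (3 * (d * q))).
{ apply (norm_le_eq (V := F) _ (minus (circulation w (u n) (v n) (z n))
    (scal (1 / 2) (minus (B (minus (v n) (u n)) (minus (z n) (u n)))
      (B (minus (z n) (u n)) (minus (v n) (u n))))))).
  { rewrite (Hsym (minus (v n) (u n))); vec F. }
  eapply Rle_trans; [apply H |].
  - intros y h Hy; apply HDd; nra.
  - assert (0 <= d * q) by nra; lra.
  - exact Hv.
  - exact Hz.
  - apply Rmult_le_compat_l; [| lra].
    apply Rmult_le_pos; nra. }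
(* The growth [4 ^ n] in [Hcirc] is cancelled exactly by the quadratic decay q^2. *)
replace eps with (4 ^ n * (eps * q * q)).
- apply Rmult_le_compat_l; [apply pow_le; lra |].
  eapply Rle_trans; [exact HC |].
  replace (eps / (6 * d * d + 1) * (2 * (d * q)) * (3 * (d * q)))
    with (eps * q * q * (6 * d * d / (6 * d * d + 1))) by (field; nra).
  rewrite <- (Rmult_1_r (eps * q * q)) at 2.
  apply Rmult_le_compat_l; [nra |].
  apply Rle_div_l; nra.
- replace 4 with (2 * 2) by ring; rewrite Rpow_mult_distr; unfold q.
  field; apply Rgt_not_eq, P.
Qed.

(** * Exact forms *)

Definition frechet_derivative (u : E -> F) (p : E) (l : E -> F) : Prop :=
  forall eps, 0 < eps -> exists delta, 0 < delta /\
  forall z : E, norm (minus z p) < delta ->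
    norm (minus (minus (u z) (u p)) (l (minus z p))) <= eps * norm (minus z p).

Lemma closed_form_exact w : norm_complete E -> differentiable_form w -> closed_form w ->
  exists u : E -> F, forall p, frechet_derivative u p (w p).
Proof.
intros HE Hw Hcl; exists (path_integral w zero); intros p eps Heps.
destruct (Hcl p) as [B [HB [HD _]]].
destruct (bilinear_norm _ HB) as [C [HC HBC]].
destruct (HD 1 Rlt_0_1) as [delta [Hdelta HDd]].
assert (He : 0 < eps / (C + 1)) by (apply Rdiv_lt_0_compat; lra).
(* With r the distance from z to p, the error is at most (1 + C) r^2: the 1 comes from the remainder
   at p, the C from the midpoint term in B. *)
exists (Rmin delta (eps / (C + 1))); split; [now apply Rmin_pos |].
intros z Hz.
assert (Hz1 := Rlt_le_trans _ _ _ Hz (Rmin_l _ _)).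
assert (Hz2 := Rlt_le_trans _ _ _ Hz (Rmin_r _ _)).
apply Rlt_div_r in Hz2; [| lra].
set (r := norm (minus z p)) in *.
assert (Hr : 0 <= r) by apply norm_ge_0.
(* This is the vanishing of the circulation around zero, p, z. *)
assert (HI : minus (path_integral w zero z) (path_integral w zero p) = path_integral w p z).
{ assert (H0 := circulation_zero w zero p z HE Hw Hcl); unfold circulation in H0.
  rewrite (path_integral_swap w zero z Hw) in H0.
  transitivity (plus (path_integral w p z) (opp (plus (plus (path_integral w zero p)
    (path_integral w p z)) (opp (path_integral w zero z))))); [vec F |].
  rewrite H0; vec F. }
rewrite HI.
assert (Ha : norm (minus (path_integral w p z)
    (plus (w p (minus z p)) (B (minus (midpoint p z) p) (minus z p)))) <= 1 * r * r).
{ apply path_integral_approx; [exact Hw | exact HB | lra | | |].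
  - intros y h Hy; apply HDd; lra.
  - now rewrite norm_minus_self.
  - apply Rle_refl. }
assert (Hm : norm (B (minus (midpoint p z) p) (minus z p)) <= C * r * r).
{ eapply Rle_trans; [apply HBC |]; fold r.
  apply Rmult_le_compat_r; [easy |]; apply Rmult_le_compat_l; [easy |].
  apply Rle_trans with (r / 2); [| lra].
  apply (norm_half_le _ (minus z p)); [unfold midpoint; vec E | apply Rle_refl]. }
apply (norm_le_eq (V := F) _ (plus (minus (path_integral w p z)
    (plus (w p (minus z p)) (B (minus (midpoint p z) p) (minus z p))))
  (B (minus (midpoint p z) p) (minus z p)))); [vec F |].
eapply Rle_trans; [apply (norm_triangle (V := F)) |].
apply Rle_trans with (1 * r * r + C * r * r); [now apply Rplus_le_compat |].
nra.
Qed.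

(** The fundamental theorem of calculus for t -> u(a + t (b - a)), whose derivative is the integrand
    by the chain rule. *)
Lemma path_integral_exact w u (a b : E) : differentiable_form w ->
  (forall p, frechet_derivative u p (w p)) -> path_integral w a b = minus (u b) (u a).
Proof.
intros Hw Hu; apply is_RInt_unique.
replace (minus (u b) (u a)) with (minus (u (segment a b 1)) (u (segment a b 0)))
  by (f_equal; f_equal; unfold segment; vec E).
apply (is_RInt_derive (fun t => u (segment a b t))).
2: { intros t _; now apply form_segment_continuous. }
intros t _; split; [apply is_linear_scal_l |].
intros x Hx; apply (is_filter_lim_locally_unique (V := R_NormedModule)) in Hx; subst x; intros eps.
set (h := minus b a); assert (Hh : 0 <= norm h) by apply norm_ge_0.
assert (He : 0 < eps / (norm h + 1)) by (apply Rdiv_lt_0_compat; [apply cond_pos | lra]).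
destruct (Hu (segment a b t) _ He) as [delta [Hdelta H]].
assert (Hd : 0 < delta / (norm h + 1)) by (apply Rdiv_lt_0_compat; lra).
exists (mkposreal _ Hd); intros s Hs.
change (Rabs (s + - t) < delta / (norm h + 1)) in Hs.
apply Rlt_div_r in Hs; [| lra].
assert (Ha := Rabs_pos (s + - t)).
assert (Hz : norm (minus (segment a b s) (segment a b t)) <= Rabs (s + - t) * norm h).
{ apply (norm_le_eq _ (scal (s + - t) h)); [unfold segment, h; vec E |].
  apply norm_scal_le. }
change (norm (minus (minus (u (segment a b s)) (u (segment a b t)))
  (scal (s + - t) (w (segment a b t) h))) <= eps * Rabs (s + - t)).
apply (norm_le_eq (V := F) _ (minus (minus (u (segment a b s)) (u (segment a b t)))
  (w (segment a b t) (minus (segment a b s) (segment a b t))))).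
{ rewrite <- (linear_scal _ (form_linear _ Hw _)); do 2 f_equal; unfold segment, h; vec E. }
eapply Rle_trans; [apply H; nra |].
eapply Rle_trans; [apply Rmult_le_compat_l; [lra | exact Hz] |].
apply Rle_trans with (eps / (norm h + 1) * (Rabs (s + - t) * (norm h + 1))).
- apply Rmult_le_compat_l; [lra |]; apply Rmult_le_compat_l; lra.
- right; field; lra.
Qed.

(** The circulation of an exact form vanishes on the triangle p, p + s h, p + s k, so
    [circulation_approx] bounds s^2/2 times the defect of symmetry by an arbitrarily small multiple
    of s^2. *)
Lemma exact_form_symmetric w u (p : E) B (h k : E) : differentiable_form w ->
  (forall p, frechet_derivative u p (w p)) ->
  bounded_bilinear B -> form_derivative w p B -> B h k = B k h.
Proof.
intros Hw Hu HB HD.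
assert (Hc : forall a b c : E, circulation w a b c = zero).
{ intros a b c; unfold circulation; rewrite !(path_integral_exact w u _ _ Hw Hu); vec F. }
assert (E0 : minus (B h k) (B k h) = zero).
2: { transitivity (plus (minus (B h k) (B k h)) (B k h)); [vec F | rewrite E0; vec F]. }
apply (norm_eq_zero (V := F)), Rle_antisym; [| apply norm_ge_0].
apply le_epsilon; intros eps Heps; rewrite Rplus_0_l.
pose (m := norm h + norm k + 1).
assert (Hh : 0 <= norm h) by apply norm_ge_0.
assert (Hk : 0 <= norm k) by apply norm_ge_0.
assert (Hm : 0 < m) by (unfold m; lra).
(* The vertices are within s m of p and the perimeter is at most 2 s m; multiplying the resulting
   bound by 2/s^2 produces the factor 4 m^2. *)
assert (He : 0 < eps / (4 * m * m)) by (apply Rdiv_lt_0_compat; nra).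
destruct (HD _ He) as [delta [Hdelta H]].
(* This makes s m equal to [delta / 2], so that the derivative estimate holds on the whole
   triangle. *)
pose (s := delta / (2 * m)).
assert (Hs : 0 < s) by (apply Rdiv_lt_0_compat; lra).
assert (Hsm : s * m < delta) by (replace (s * m) with (delta / 2) by (unfold s; field; lra); lra).
assert (N : forall x y : E, x = scal s y -> norm x <= s * norm y).
{ intros x y ->; generalize (norm_scal_le s y); now rewrite Rabs_pos_eq by lra. }
assert (Nh := N (minus (plus p (scal s h)) p) h ltac:(vec E)).
assert (Nk := N (minus (plus p (scal s k)) p) k ltac:(vec E)).
assert (Nk' : norm (minus p (plus p (scal s k))) <= s * norm k).
{ now rewrite norm_minus_sym. }
assert (Nd : norm (minus (plus p (scal s k)) (plus p (scal s h))) <= s * norm k + s * norm h).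
{ generalize (norm_minus_trans (plus p (scal s k)) p (plus p (scal s h))).
  rewrite (norm_minus_sym p (plus p (scal s h))); lra. }
assert (HC := circulation_approx w p B _ (s * m) p (plus p (scal s h)) (plus p (scal s k))
  Hw HB (Rlt_le _ _ He)).
(* As the circulation is zero, the factor -2/s^2 recovers exactly the defect of symmetry. *)
apply (norm_le_eq (V := F) _ (scal (- (2 / (s * s)))
  (minus (circulation w p (plus p (scal s h)) (plus p (scal s k)))
    (scal (1 / 2) (minus
      (B (minus (plus p (scal s h)) p) (minus (plus p (scal s k)) p))
      (B (minus (plus p (scal s k)) p) (minus (plus p (scal s h)) p))))))).
{ rewrite Hc.
  replace (minus (plus p (scal s h)) p) with (scal s h) by vec E.
  replace (minus (plus p (scal s k)) p) with (scal s k) by vec E.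
  rewrite !(linear_scal _ (bilinear_l _ HB _)), !(linear_scal _ (bilinear_r _ HB _)).
  vec F; lra. }
eapply Rle_trans; [apply (norm_scal_le (V := F)) |].
rewrite Rabs_Ropp, Rabs_pos_eq
  by (apply Rmult_le_pos; [lra | apply Rlt_le, Rinv_0_lt_compat; nra]).
apply Rle_trans with (2 / (s * s) * (eps / (4 * m * m) * (s * m) * (2 * (s * m)))).
- apply Rmult_le_compat_l.
  { apply Rmult_le_pos; [lra | apply Rlt_le, Rinv_0_lt_compat; nra]. }
  eapply Rle_trans; [apply HC |].
  + intros z y Hz; apply H; lra.
  + rewrite norm_minus_self; nra.
  + unfold m; nra.
  + unfold m; nra.
  + apply Rmult_le_compat_l; [| unfold m; nra].
    apply Rmult_le_pos; nra.
- right; field; lra.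
Qed.

End OneForms.

(** * Banach D-modules as real Banach spaces *)

(* An additive g on R with g 1 = 0 is periodic; if moreover |g t| <= K |t|, then g is
   bounded, so n g t = g (n t) forces g = 0. *)
Lemma additive_bounded_linear {U V : NormedModule R_AbsRing} (f : U -> V) :
  (forall x y, f (plus x y) = plus (f x) (f y)) ->
  (exists C, forall x, norm (f x) <= C * norm x) -> is_linear f.
Proof.
intros Hadd [C HC].
assert (Hn : forall (n : nat) x, f (scal (INR n) x) = scal (INR n) (f x)).
{ intros n x; induction n as [| n IH].
  - assert (f zero = zero).
    { transitivity (minus (f (plus zero zero)) (f zero)); [rewrite Hadd; vec V |].
      rewrite plus_zero_l; vec V. }
    transitivity (f zero); [f_equal; simpl INR; vec U |].
    rewrite H; simpl INR; vec V.
  - rewrite S_INR; transitivity (f (plus (scal (INR n) x) x)); [f_equal; vec U |].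
    rewrite Hadd, IH; vec V. }
assert (Hopp : forall x, f (opp x) = opp (f x)).
{ intros x; transitivity (minus (f (plus (opp x) x)) (f x)); [rewrite Hadd; vec V |].
  transitivity (minus (f (scal (INR 0) x)) (f x)); [do 2 f_equal; simpl INR; vec U |].
  rewrite Hn; simpl INR; vec V. }
assert (Hpos : forall t x, 0 <= t -> f (scal t x) = scal t (f x)).
{ intros t x Ht.
  pose (g t := minus (f (scal t x)) (scal t (f x))).
  pose (K := Rabs C * norm x + norm (f x)).
  assert (HK : 0 <= K).
  { assert (0 <= Rabs C * norm x) by (apply Rmult_le_pos; [apply Rabs_pos | apply norm_ge_0]).
    generalize (norm_ge_0 (f x)); unfold K; lra. }
  assert (Hg : forall s, 0 <= s -> norm (g s) <= K).
  { intros s Hs; destruct (nfloor_ex s Hs) as [n Hn'].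
    assert (E : g s = minus (f (scal (s - INR n) x)) (scal (s - INR n) (f x))).
    { unfold g; transitivity (minus (f (plus (scal (INR n) x) (scal (s - INR n) x)))
        (scal s (f x))); [do 2 f_equal; vec U |].
      rewrite Hadd, Hn; vec V. }
    rewrite E; unfold minus at 1.
    eapply Rle_trans; [apply norm_triangle |]; rewrite norm_opp.
    assert (N1 : norm (scal (s - INR n) x) <= norm x).
    { generalize (norm_scal_le (s - INR n) x) (norm_ge_0 x).
      rewrite Rabs_pos_eq by lra; nra. }
    apply Rplus_le_compat.
    - eapply Rle_trans; [apply HC |].
      eapply Rle_trans; [apply Rmult_le_compat_r; [apply norm_ge_0 | apply Rle_abs] |].
      apply Rmult_le_compat_l; [apply Rabs_pos | exact N1].
    - generalize (norm_scal_le (s - INR n) (f x)) (norm_ge_0 (f x)).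
      rewrite Rabs_pos_eq by lra; nra. }
  assert (E : g t = zero).
  { apply norm_eq_zero, Rle_antisym; [| apply norm_ge_0].
    apply le_epsilon; intros eps Heps; rewrite Rplus_0_l.
    destruct (archimed_cor1 (eps / (K + 1))) as [n [Hn1 Hn2]].
    { apply Rdiv_lt_0_compat; lra. }
    assert (P : 0 < INR n) by now apply lt_0_INR.
    assert (En : g t = scal (/ INR n) (g (INR n * t))).
    { unfold g; transitivity (scal (/ INR n) (minus (f (scal (INR n) (scal t x)))
        (scal (INR n * t) (f x)))).
      - rewrite Hn; vec V; lra.
      - do 3 f_equal; vec U. }
    rewrite En; eapply Rle_trans; [apply norm_scal_le |].
    assert (Hi : 0 < / INR n) by now apply Rinv_0_lt_compat.
    rewrite Rabs_pos_eq by lra.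
    assert (Hb := Hg (INR n * t) ltac:(nra)).
    apply Rlt_div_r in Hn1; [| lra]; nra. }
  transitivity (plus (g t) (scal t (f x))); [unfold g; vec V | rewrite E; vec V]. }
split.
- exact Hadd.
- intros t x; destruct (Rle_dec 0 t) as [Ht | Ht]; [now apply Hpos |].
  transitivity (f (opp (scal (- t) x))); [f_equal; vec U |].
  rewrite Hopp, Hpos by lra; vec V.
- exists (Rabs C + 1); split; [generalize (Rabs_pos C); lra |].
  intros x; eapply Rle_trans; [apply HC |].
  apply Rmult_le_compat_r; [apply norm_ge_0 | generalize (Rle_abs C); lra].
Qed.

Lemma complete_norm_complete (V : CompleteNormedModule R_AbsRing) : norm_complete V.
Proof.
intros u Hu.
destruct (proj1 (filterlim_locally_cauchy (F := eventually) (U := V) u)) as [p Hp].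
- intros eps; assert (Heps := cond_pos eps).
  destruct (Hu (eps / 4)) as [N HN]; [lra |].
  exists (fun n => (N <= n)%nat); split; [now exists N |].
  intros m n Hm Hn; apply (norm_compat1 (V := V)).
  eapply Rle_lt_trans; [apply (norm_minus_trans (V := V) _ (u N)) |].
  rewrite (norm_minus_sym (V := V) (u N)).
  generalize (HN m Hm) (HN n Hn); lra.
- exists p; intros eps Heps.
  destruct (Hp (fun y => norm (minus y p) <= eps)) as [N HN].
  + apply (locally_le_locally_norm (V := V) p).
    exists (mkposreal eps Heps); intros y Hy; apply Rlt_le, Hy.
  + exists N; exact HN.
Qed.

(** The product carries the Euclidean norm; its bound sqrt 2 times the maximum is weakened to keep
    later estimates linear. *)
Lemma prod_norm_le {U V : NormedModule R_AbsRing} (x : U * V) :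
  norm x <= 2 * (norm (fst x) + norm (snd x)).
Proof.
destruct x as [x y]; simpl.
eapply Rle_trans; [apply (norm_prod (U := U) (V := V)) |].
assert (Hx := norm_ge_0 x); assert (Hy := norm_ge_0 y).
assert (Rmax (norm x) (norm y) <= norm x + norm y) by (apply Rmax_lub; lra).
assert (0 <= Rmax (norm x) (norm y)) by (eapply Rle_trans; [exact Hx | apply Rmax_l]).
assert (sqrt 2 <= 2).
{ rewrite <- (sqrt_square 2) at 2 by lra; apply sqrt_le_1; lra. }
assert (0 <= sqrt 2) by apply sqrt_pos.
apply Rmult_le_compat; lra.
Qed.

Lemma prod_norm_complete (U V : NormedModule R_AbsRing) :
  norm_complete U -> norm_complete V -> norm_complete (prod_NormedModule R_AbsRing U V).
Proof.
intros HU HV u Hu.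
destruct (HU (fun n => fst (u n))) as [p Hp].
{ intros eps Heps; destruct (Hu eps Heps) as [N HN]; exists N; intros n Hn.
  eapply Rle_trans; [| apply (HN n Hn)].
  exact (norm_le_prod_norm_1 (U := U) (V := V) (minus (u n) (u N))). }
destruct (HV (fun n => snd (u n))) as [q Hq].
{ intros eps Heps; destruct (Hu eps Heps) as [N HN]; exists N; intros n Hn.
  eapply Rle_trans; [| apply (HN n Hn)].
  exact (norm_le_prod_norm_2 (U := U) (V := V) (minus (u n) (u N))). }
exists (p, q); intros eps Heps.
destruct (Hp (eps / 4)) as [N1 H1]; [lra |].
destruct (Hq (eps / 4)) as [N2 H2]; [lra |].
exists (max N1 N2); intros n Hn.
eapply Rle_trans; [apply prod_norm_le |].
assert (H1' := H1 n ltac:(lia)); assert (H2' := H2 n ltac:(lia)).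
change (2 * (norm (minus (fst (u n)) p) + norm (minus (snd (u n)) q)) <= eps).
lra.
Qed.

Section RealModule.

Context {D : CompleteNormedCommRing} (X : BanachModule D).

Definition real_ModuleSpace_mixin : ModuleSpace.mixin_of R_Ring X.
Proof.
apply (ModuleSpace.Mixin R_Ring X rscal).
- exact rscal_assoc.
- exact rscal_one.
- exact rscal_distr_l.
- exact rscal_distr_r.
Defined.

Definition real_NormedModuleAux : NormedModuleAux R_AbsRing :=
  NormedModuleAux.Pack R_AbsRing X
    (NormedModuleAux.Class R_AbsRing X
      (ModuleSpace.Class R_Ring X (AbelianGroup.class X) real_ModuleSpace_mixin)
      (UniformSpace.class X)) X.

Definition real_NormedModule_mixin : NormedModule.mixin_of R_AbsRing real_NormedModuleAux.
Proof.
apply (NormedModule.Mixin R_AbsRing real_NormedModuleAux (norm (V := X))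
  (norm_factor (V := X))).
- exact norm_triangle.
- exact norm_rscal.
- exact norm_compat1.
- exact norm_compat2.
- exact norm_eq_zero.
Defined.

(** Only the scalars change: carrier, group, uniform structure and norm are those of X, so
    statements about norms transfer by conversion. *)
Definition real_module : CompleteNormedModule R_AbsRing :=
  CompleteNormedModule.Pack R_AbsRing X
    (CompleteNormedModule.Class R_AbsRing X
      (NormedModule.Class R_AbsRing X _ real_NormedModule_mixin)
      (CompleteNormedModule.mixin D X (CompleteNormedModule.class D X))) X.

End RealModule.

(** * The form of the pair (M, N) *)

(** This form of the derivative estimate mentions only the group and the norm, and therefore reads
    the same over D and over the reals. *)
Lemma is_derivative_norm {D : CompleteNormedCommRing} {U V : NormedModule D}
    (f : U -> V) (x : U) (l : linmap U V) :
  is_derivative f x l <->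
  forall eps, 0 < eps -> exists delta, 0 < delta /\ forall z : U, norm (minus z x) < delta ->
    norm (minus (minus (f z) (f x)) (l (minus z x))) <= eps * norm (minus z x).
Proof.
split.
- intros [_ H] eps Heps.
  destruct (locally_norm_le_locally x _ (H x (fun P HP => HP) (mkposreal eps Heps)))
    as [delta Hd].
  exists delta; split; [apply cond_pos | exact Hd].
- intros H; split; [apply linmap_linear |].
  intros y Hy; apply is_filter_lim_locally_unique in Hy; subst y; intros eps.
  destruct (H eps (cond_pos eps)) as [delta [Hdelta Hd]].
  apply locally_le_locally_norm; exists (mkposreal delta Hdelta); exact Hd.
Qed.

Notation real_prod X Y := (prod_NormedModule R_AbsRing (real_module X) (real_module Y)).

Section PairForm.

Context {D : CompleteNormedCommRing} {X Y A : BanachModule D}.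
Context (M : X * Y -> linmap X A) (N : X * Y -> linmap Y A).

Notation Z := (real_prod X Y).

Definition pair_form (z h : Z) : real_module A :=
  plus (M z (fst h)) (N z (snd h)).

(** The direction k comes first, as in [form_derivative] and opposite to [app2]. *)
Definition pair_form_derivative (lM : linmap (prod_NormedModule D X Y) (linmap_NormedModule X A))
    (lN : linmap (prod_NormedModule D X Y) (linmap_NormedModule Y A)) (k h : Z) : real_module A :=
  plus (lM k (fst h)) (lN k (snd h)).

Lemma pair_plus_linear (l1 : linmap X A) (l2 : linmap Y A) :
  is_linear (fun h : prod_NormedModule D X Y => plus (l1 (fst h)) (l2 (snd h))).
Proof.
apply is_linear_add.
- apply (is_linear_comp fst l1); [apply is_linear_fst | apply linmap_linear].
- apply (is_linear_comp snd l2); [apply is_linear_snd | apply linmap_linear].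
Qed.

Lemma pair_plus_norm (l1 : linmap X A) (l2 : linmap Y A) (h : Z) :
  norm (plus (l1 (fst h)) (l2 (snd h))) <= (opnorm l1 + opnorm l2) * norm h.
Proof.
eapply Rle_trans; [apply norm_triangle |].
rewrite Rmult_plus_distr_r; apply Rplus_le_compat.
- eapply Rle_trans; [apply opnorm_bound |].
  apply Rmult_le_compat_l; [apply opnorm_ge_0 |].
  exact (norm_le_prod_norm_1 (U := real_module X) (V := real_module Y) h).
- eapply Rle_trans; [apply opnorm_bound |].
  apply Rmult_le_compat_l; [apply opnorm_ge_0 |].
  exact (norm_le_prod_norm_2 (U := real_module X) (V := real_module Y) h).
Qed.

(** Additivity is inherited from D-linearity and boundedness from the operator norms; together they
    give linearity over the reals. *)
Lemma pair_plus_real_linear (l1 : linmap X A) (l2 : linmap Y A) :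
  is_linear (U := Z) (V := real_module A) (fun h => plus (l1 (fst h)) (l2 (snd h))).
Proof.
apply additive_bounded_linear.
- exact (linear_plus _ (pair_plus_linear l1 l2)).
- exists (opnorm l1 + opnorm l2); apply pair_plus_norm.
Qed.

Lemma pair_form_bilinear lM lN : bounded_bilinear (pair_form_derivative lM lN).
Proof.
assert (HB : exists C, 0 <= C /\ forall k h : Z,
  norm (pair_form_derivative lM lN k h) <= C * norm k * norm h).
{ exists (opnorm lM + opnorm lN); split.
  { generalize (opnorm_ge_0 lM) (opnorm_ge_0 lN); lra. }
  intros k h; eapply Rle_trans; [apply pair_plus_norm |].
  apply Rmult_le_compat_r; [apply norm_ge_0 |].
  rewrite Rmult_plus_distr_r; apply Rplus_le_compat.
  - exact (opnorm_bound lM k).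
  - exact (opnorm_bound lN k). }
split; [| | exact HB].
- intros h; apply additive_bounded_linear.
  + intros k1 k2; unfold pair_form_derivative.
    transitivity (plus (plus (lM k1 (fst h)) (lM k2 (fst h)))
      (plus (lN k1 (snd h)) (lN k2 (snd h)))).
    * f_equal.
      -- exact (f_equal (fun l : linmap X A => l (fst h)) (linear_plus _ (linmap_linear lM) k1 k2)).
      -- exact (f_equal (fun l : linmap Y A => l (snd h)) (linear_plus _ (linmap_linear lN) k1 k2)).
    * vec (real_module A).
  + destruct HB as [C [HC H]]; exists (C * norm h); intros k.
    rewrite Rmult_assoc, (Rmult_comm (norm h)), <- Rmult_assoc; apply H.
- intros k; apply pair_plus_real_linear.
Qed.

Lemma pair_form_diff z lM lN : is_derivative M z lM -> is_derivative N z lN ->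
  form_derivative pair_form z (pair_form_derivative lM lN).
Proof.
intros HM HN eps Heps.
destruct (proj1 (is_derivative_norm _ _ _) HM (eps / 2)) as [d1 [Hd1 H1]]; [lra |].
destruct (proj1 (is_derivative_norm _ _ _) HN (eps / 2)) as [d2 [Hd2 H2]]; [lra |].
exists (Rmin d1 d2); split; [now apply Rmin_pos |].
intros y h Hy.
assert (H1' := H1 y (Rlt_le_trans _ _ _ Hy (Rmin_l _ _))).
assert (H2' := H2 y (Rlt_le_trans _ _ _ Hy (Rmin_r _ _))).
(* The remainder of the form is the sum of the operator remainders of M and N applied to h, so their
   operator norms control it uniformly in h. *)
apply (norm_le_eq (V := real_module A) _
  (plus ((minus (minus (M y) (M z)) (lM (minus y z)) : linmap X A) (fst h))
    ((minus (minus (N y) (N z)) (lN (minus y z)) : linmap Y A) (snd h)))).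
{ unfold pair_form, pair_form_derivative.
  change (minus (minus (plus (M y (fst h)) (N y (snd h))) (plus (M z (fst h)) (N z (snd h))))
    (plus (lM (minus y z) (fst h)) (lN (minus y z) (snd h))) =
    plus (minus (minus (M y (fst h)) (M z (fst h))) (lM (minus y z) (fst h)))
      (minus (minus (N y (snd h)) (N z (snd h))) (lN (minus y z) (snd h)))).
  vec (real_module A). }
eapply Rle_trans; [apply pair_plus_norm |].
apply Rmult_le_compat_r; [apply norm_ge_0 |].
replace (eps * norm (minus y z)) with (eps / 2 * norm (minus y z) + eps / 2 * norm (minus y z))
  by field.
exact (Rplus_le_compat _ _ _ _ H1' H2').
Qed.

Lemma pair_form_differentiable :
  differentiable M -> differentiable N -> differentiable_form pair_form.
Proof.
intros HM HN; split.
- intros z; apply pair_plus_real_linear.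
- intros z; destruct (HM z) as [lM HlM], (HN z) as [lN HlN].
  exists (pair_form_derivative lM lN); split; [apply pair_form_bilinear |].
  now apply pair_form_diff.
Qed.

End PairForm.

(** * Partial derivatives as restrictions of the total derivative *)

Lemma is_linear_inl {K : AbsRing} {U V : NormedModule K} :
  is_linear (fun h : U => (h, zero : V)).
Proof. apply is_linear_prod; [apply is_linear_id | apply is_linear_zero]. Qed.

Lemma is_linear_inr {K : AbsRing} {U V : NormedModule K} :
  is_linear (fun h : V => (zero : U, h)).
Proof. apply is_linear_prod; [apply is_linear_zero | apply is_linear_id]. Qed.

Lemma norm_inl {K : AbsRing} {U V : NormedModule K} (x : U) :
  norm ((x, zero) : prod_NormedModule K U V) = norm x.
Proof.
change (sqrt (norm x ^ 2 + norm (zero : V) ^ 2) = norm x).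
rewrite norm_zero; simpl; rewrite Rmult_0_l, Rplus_0_r, Rmult_1_r.
apply sqrt_square, norm_ge_0.
Qed.

Lemma norm_inr {K : AbsRing} {U V : NormedModule K} (y : V) :
  norm ((zero, y) : prod_NormedModule K U V) = norm y.
Proof.
change (sqrt (norm (zero : U) ^ 2 + norm y ^ 2) = norm y).
rewrite norm_zero; simpl; rewrite Rmult_0_l, Rplus_0_l, Rmult_1_r.
apply sqrt_square, norm_ge_0.
Qed.

Lemma linmap_pair {D : CompleteNormedCommRing} {U V W : NormedModule D}
    (l : linmap (prod_NormedModule D U V) W) (h : U) (k : V) :
  l (h, k) = plus (l (h, zero)) (l (zero, k)).
Proof.
rewrite <- (linear_plus _ (linmap_linear l)); f_equal.
change ((h, k) = (plus h zero, plus zero k)).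
now rewrite plus_zero_r, plus_zero_l.
Qed.

Section Partials.

Context {D : CompleteNormedCommRing} {X Y : BanachModule D} {V : NormedModule D}.
Context (f : X * Y -> V).

(** Restricting the total estimate to increments (z - x, 0), which have the norm of z - x, gives a
    derivative in x alone; uniqueness of derivatives identifies it with the partial one. *)
Lemma partial_x_eq x y (l : linmap (prod_NormedModule D X Y) V) (h : X) :
  is_derivative f (x, y) l -> partial_x f (x, y) h = l (h, zero).
Proof.
intros Hl; unfold partial_x; simpl.
rewrite (is_derivative_unique _ x
  (Linmap _ (is_linear_comp _ _ is_linear_inl (linmap_linear l)))); [easy |].
apply is_derivative_norm; intros eps Heps.
destruct (proj1 (is_derivative_norm _ _ _) Hl eps Heps) as [delta [Hdelta H]].
exists delta; split; [easy |]; intros z Hz; simpl.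
assert (H' := H (z, y)).
change (norm ((minus z x, minus y y) : prod_NormedModule D X Y) < delta ->
  norm (minus (minus (f (z, y)) (f (x, y))) (l (minus z x, minus y y))) <=
  eps * norm ((minus z x, minus y y) : prod_NormedModule D X Y)) in H'.
rewrite (minus_eq_zero y), (norm_inl (U := X) (V := Y)) in H'.
exact (H' Hz).
Qed.

Lemma partial_y_eq x y (l : linmap (prod_NormedModule D X Y) V) (h : Y) :
  is_derivative f (x, y) l -> partial_y f (x, y) h = l (zero, h).
Proof.
intros Hl; unfold partial_y; simpl.
rewrite (is_derivative_unique _ y
  (Linmap _ (is_linear_comp _ _ is_linear_inr (linmap_linear l)))); [easy |].
apply is_derivative_norm; intros eps Heps.
destruct (proj1 (is_derivative_norm _ _ _) Hl eps Heps) as [delta [Hdelta H]].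
exists delta; split; [easy |]; intros z Hz; simpl.
assert (H' := H (x, z)).
change (norm ((minus x x, minus z y) : prod_NormedModule D X Y) < delta ->
  norm (minus (minus (f (x, z)) (f (x, y))) (l (minus x x, minus z y))) <=
  eps * norm ((minus x x, minus z y) : prod_NormedModule D X Y)) in H'.
rewrite (minus_eq_zero x), (norm_inr (U := X) (V := Y)) in H'.
exact (H' Hz).
Qed.

Lemma total_derivative_eq x y (l : linmap (prod_NormedModule D X Y) V) (h : X) (k : Y) :
  is_derivative f (x, y) l ->
  l (h, k) = plus (partial_x f (x, y) h) (partial_y f (x, y) k).
Proof.
intros Hl; rewrite (partial_x_eq _ _ _ _ Hl), (partial_y_eq _ _ _ _ Hl).
apply linmap_pair.
Qed.

End Partials.

(** * Integrability as symmetry of the derivative of the form *)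

Theorem theorem7p2p2 (D : CompleteNormedCommRing)
    (X Y : BanachModule D) (A : BanachAlgebra D)
    (M : X * Y -> linmap X A) (N : X * Y -> linmap Y A)
    (HM : differentiable M) (HN : differentiable N) :
  integrable M N <->
  forall (x : X) (y : Y) (dx dx1 dx2 : X) (dy dy1 dy2 : Y),
    app2 (partial_x M (x, y)) dx1 dx2 = app2 (partial_x M (x, y)) dx2 dx1 /\
    app2 (partial_y N (x, y)) dy1 dy2 = app2 (partial_y N (x, y)) dy2 dy1 /\
    app2 (partial_y M (x, y)) dx dy = app2 (partial_x N (x, y)) dy dx.
Proof.
assert (Hw := pair_form_differentiable M N HM HN).
split.
- intros [u [Hu Hpart]] x y dx dx1 dx2 dy dy1 dy2.
  (* The total derivative of u is the sum of its partial derivatives, hence the value of the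
     form. *)
  assert (Hgrad : forall (p : X) (q : Y), frechet_derivative (E := real_prod X Y)
    (F := real_module A) u (p, q) (pair_form M N (p, q))).
  { intros p q; destruct (Hu (p, q)) as [l Hl].
    assert (El : forall (h : X) (k : Y), l (h, k) = plus (M (p, q) h) (N (p, q) k)).
    { intros h k; destruct (Hpart p q) as [E1 E2].
      exact (eq_trans (total_derivative_eq u p q l h k Hl)
        (f_equal2 (fun (l1 : linmap X A) (l2 : linmap Y A) => plus (l1 h) (l2 k)) E1 E2)). }
    intros eps Heps.
    destruct (proj1 (is_derivative_norm _ _ _) Hl eps Heps) as [delta [Hdelta H]].
    exists delta; split; [easy |]; intros z Hz.
    apply (norm_le_eq (V := real_module A) _ (minus (minus (u z) (u (p, q)))
      (l (minus z (p, q))))); [| exact (H z Hz)].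
    f_equal; symmetry; exact (El (minus (fst z) p) (minus (snd z) q)). }
  destruct (HM (x, y)) as [lM HlM], (HN (x, y)) as [lN HlN].
  assert (Hsym := fun h k => exact_form_symmetric _ _ _ _ h k Hw
    (fun p => match p with (p, q) => Hgrad p q end)
    (pair_form_bilinear lM lN) (pair_form_diff M N _ _ _ HlM HlN)).
  unfold pair_form_derivative in Hsym.
  unfold app2; rewrite !(partial_x_eq _ _ _ _ _ HlM), !(partial_y_eq _ _ _ _ _ HlM),
    !(partial_x_eq _ _ _ _ _ HlN), !(partial_y_eq _ _ _ _ _ HlN).
  assert (Z1 : forall l : linmap X A, l zero = zero).
  { intros l; apply linear_zero, linmap_linear. }
  assert (Z2 : forall l : linmap Y A, l zero = zero).
  { intros l; apply linear_zero, linmap_linear. }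
  split; [| split].
  (* Vectors supported in one factor isolate the three conditions: both in X, both in Y, one in
     each. *)
  + generalize (Hsym (dx2, zero) (dx1, zero)); simpl.
    now rewrite !Z2, !plus_zero_r.
  + generalize (Hsym (zero, dy2) (zero, dy1)); simpl.
    now rewrite !Z1, !plus_zero_l.
  + generalize (Hsym (zero, dy) (dx, zero)); simpl.
    now rewrite Z1, Z2, plus_zero_l, plus_zero_r.
- intros Hsym.
  destruct (closed_form_exact (pair_form M N)) as [u Hu].
  + apply prod_norm_complete; apply complete_norm_complete.
  + exact Hw.
  + intros [x y]; destruct (HM (x, y)) as [lM HlM], (HN (x, y)) as [lN HlN].
    exists (pair_form_derivative lM lN); split; [apply pair_form_bilinear |].
    split; [now apply pair_form_diff |].
    intros [h1 k1] [h2 k2]; unfold pair_form_derivative; simpl.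
    rewrite (linmap_pair lM h1), (linmap_pair lM h2),
      (linmap_pair lN h1), (linmap_pair lN h2).
    (* Each side has four terms, two of them mixed; the mixed condition is applied at (h2, k1) and
       at (h1, k2), and exchanges terms of [lM] and [lN]. *)
    destruct (Hsym x y h2 h1 h2 k1 k1 k2) as [S1 [S2 S3]].
    destruct (Hsym x y h1 h1 h2 k2 k1 k2) as [_ [_ S4]].
    unfold app2 in S1, S2, S3, S4.
    rewrite !(partial_x_eq _ _ _ _ _ HlM) in S1.
    rewrite !(partial_y_eq _ _ _ _ _ HlN) in S2.
    rewrite (partial_y_eq _ _ _ _ _ HlM), (partial_x_eq _ _ _ _ _ HlN) in S3.
    rewrite (partial_y_eq _ _ _ _ _ HlM), (partial_x_eq _ _ _ _ _ HlN) in S4.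
    exact (eq_trans
      (plus_swap (V := real_module A) (lM (h1, zero) h2) (lM (zero, k1) h2)
        (lN (h1, zero) k2) (lN (zero, k1) k2))
      (f_equal2 plus (f_equal2 plus (eq_sym S1) (eq_sym S4))
        (f_equal2 plus S3 (eq_sym S2)))).
  (* The primitive was found over the reals, but its estimate involves only norms and its derivative
     is D-linear, so u is differentiable over D. *)
  + assert (Hder : forall p, is_derivative u p (Linmap _ (pair_plus_linear (M p) (N p)))).
    { intros p; apply is_derivative_norm; exact (Hu p). }
    exists u; split; [intros p; eexists; apply Hder |].
    intros x y; split; apply linmap_ext; intros h.
    * rewrite (partial_x_eq _ _ _ _ _ (Hder (x, y))); simpl.
      rewrite (linear_zero _ (linmap_linear _)); apply plus_zero_r.
    * rewrite (partial_y_eq _ _ _ _ _ (Hder (x, y))); simpl.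
      rewrite (linear_zero _ (linmap_linear _)); apply plus_zero_l.
Qed.
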